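(* For every integer $m\ge1$, $$\mathrm m_{\mathbb D}(P_m)=\int_0^{+\infty}\left(y+\frac{e^{-2y}-1}{2}\right)\rho^{*m}(y)\,\mathrm dy.$$
   Context: Let $\mathbb D=\{z\in\mathbb C:|z|<1\}$, $\mathrm dA$ planar Lebesgue measure. For a nonzero polynomial $F\in\mathbb C[z_1,\ldots,z_n]$, the areal Mahler measure is $\mathrm m_{\mathbb D}(F)=\pi^{-n}\int_{\mathbb D^n}\log|F(z_1,\ldots,z_n)|\,\mathrm dA(z_1)\cdots\mathrm dA(z_n)$. For $m\ge1$, $$P_m(x_1,\ldots,x_m,u)=\prod_{j=1}^m(1+x_j)+u\prod_{j=1}^m(1-x_j).$$ Let $X$ be uniformly distributed on $\mathbb D$ with respect to normalized area measure $\pi^{-1}\mathrm dA$, $q(z)=(1-z)/(1+z)$, $Y=\log|q(X)|$, and let $\rho$ be the probability density of $Y$ on $\mathbb R$. For an integrable density $f$ on $\mathbb R$, $f^{*m}$ denotes its $m$-fold convolution ($f^{*1}=f$). *)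

(* Defs.v *)
From HB Require Import structures.
From mathcomp Require Import all_boot all_order all_algebra.
From mathcomp Require Import complex.
(* The notations of mpoly clash with those of mathcomp-analysis. *)
From mathcomp Require Import -(notations) mpoly.
From mathcomp Require Import all_classical all_reals all_analysis.

Set Implicit Arguments.
Unset Strict Implicit.
Unset Printing Implicit Defensive.

Import Order.TTheory GRing.Theory Num.Theory.
Import numFieldNormedType.Exports.

Local Open Scope classical_set_scope.
Local Open Scope ring_scope.

(* In mathcomp-analysis the sigma-finite instance of a product measure is
   shadowed by the one for products of subprobabilities, hence this lemma. *)
Lemma sigma_finite_product d1 d2 (T1 : measurableType d1)
    (T2 : measurableType d2) (R : realType)
    (m1 : {sigma_finite_measure set T1 -> \bar R})
    (m2 : {sigma_finite_measure set T2 -> \bar R}) :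
  sigma_finite [set: T1 * T2] (m1 \x m2)%E.
Proof.
have /sigma_finiteP[F [TF ndF Foo]] := sigma_finiteT m1.
have /sigma_finiteP[G [TG ndG Goo]] := sigma_finiteT m2.
exists (fun n => F n `*` G n).
  rewrite -setXTT TF TG predeqE => -[x y]; split.
    move=> [/= [n _ Fnx] [k _ Gky]]; exists (maxn n k) => //; split.
    - by move: x Fnx; exact/subsetPset/ndF/leq_maxl.
    - by move: y Gky; exact/subsetPset/ndG/leq_maxr.
  by move=> [n _ []/= ? ?]; split; exists n.
move=> k; have [? ?] := Foo k; have [? ?] := Goo k.
split; first exact: measurableX.
by rewrite product_measure1E// lte_mul_pinfty// ge0_fin_numE.
Qed.

Section tuple_measure.
Local Open Scope ereal_scope.
Context d (T : measurableType d) (R : realType).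
Variable mu : {sigma_finite_measure set T -> \bar R}.

Section cons_measure.
Variables (n : nat) (nu : {sigma_finite_measure set (n.-tuple T) -> \bar R}).

Definition cons_pair (p : T * n.-tuple T) : n.+1.-tuple T :=
  [the n.+1.-tuple T of p.1 :: p.2].

Lemma measurable_cons_pair : measurable_fun [set: T * n.-tuple T] cons_pair.
Proof. exact: measurable_cons. Qed.

Definition cons_measure : set (n.+1.-tuple T) -> \bar R :=
  pushforward (mu \x nu) cons_pair.

Let cons_measure0 : cons_measure set0 = 0.
Proof. by rewrite /cons_measure /pushforward preimage_set0 measure0. Qed.

Let cons_measure_ge0 A : 0 <= cons_measure A.
Proof. by apply: integral_ge0 => x _; exact: measure_ge0. Qed.

Let cons_measure_semi_sigma_additive : semi_sigma_additive cons_measure.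
Proof.
move=> F mF tF mUF; rewrite /cons_measure /pushforward preimage_bigcup.
apply: measure_semi_sigma_additive.
- by move=> k; rewrite -[X in measurable X]setTI; exact: measurable_cons_pair.
- apply/trivIsetP => /= i j _ _ ij; rewrite -preimage_setI.
  by move/trivIsetP : tF => /(_ _ _ _ _ ij) ->//; rewrite preimage_set0.
- rewrite -preimage_bigcup -[X in measurable X]setTI.
  exact: measurable_cons_pair.
Qed.

HB.instance Definition _ := isMeasure.Build _ _ _ cons_measure
  cons_measure0 cons_measure_ge0 cons_measure_semi_sigma_additive.

Let cons_measure_sigma_finite : sigma_finite setT cons_measure.
Proof.
have [F FT Foo] := sigma_finite_product mu nu.
pose uncons (t : n.+1.-tuple T) := (thead t, [tuple of behead t]).
have muncons : measurable_fun setT uncons.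
  by apply/measurable_fun_pair; [exact: measurable_tnth|exact: measurable_behead].
have consK p : uncons (cons_pair p) = p.
  by case: p => x t; congr pair; exact/val_inj.
exists (fun k => uncons @^-1` (F k)).
  by rewrite -preimage_bigcup -FT preimage_setT.
move=> k; have [mFk Fkoo] := Foo k; split.
  by rewrite -[X in measurable X]setTI; exact: muncons.
rewrite /cons_measure /pushforward -comp_preimage.
by rewrite (_ : uncons \o cons_pair = id) //; exact/funext.
Qed.

HB.instance Definition _ := Measure_isSigmaFinite.Build _ _ _ cons_measure
  cons_measure_sigma_finite.

End cons_measure.

(* mathcomp-analysis has product measures on pairs only: this is the n-fold
   product of mu with itself, carried by the library's n.-tuple T. *)
Fixpoint tuple_measure (n : nat) :
    {sigma_finite_measure set (n.-tuple T) -> \bar R} :=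
  match n with
  | 0 => \d_[tuple]
  | k.+1 => cons_measure (tuple_measure k)
  end.

End tuple_measure.

(* The planar sigma-algebra must be built from measurableTypeR R, on which
   lebesgue_measure is defined. *)
Notation plane R := (measurableTypeR R * measurableTypeR R)%type.

Section areal_mahler.
Context (R : realType).

(* plane R carries the measurable structure and the product Lebesgue measure;
   R[i] carries the field structure. *)
Definition toC (z : plane R) : R[i] := ((z.1 : R) +i* (z.2 : R))%C.

Definition cabs (z : R[i]) : R := ComplexField.Normc.normc z.

Definition area : set (plane R) -> \bar R :=
  (lebesgue_measure \x lebesgue_measure)%E.

HB.instance Definition _ := Measure.on area.

HB.instance Definition _ := Measure_isSigmaFinite.Build _ _ _ area
  (sigma_finite_product lebesgue_measure lebesgue_measure).

Definition unit_disk : set (plane R) := [set z | cabs (toC z) < 1].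

Definition polydisk (n : nat) : set (n.-tuple (plane R)) :=
  [set z | forall i, unit_disk (tnth z i)].

(* lne is used so that log 0 = -oo. *)
Definition areal_mahler (n : nat) (F : mpoly n R[i]) : \bar R :=
  ((pi ^- n)%:E * \int[tuple_measure area n]_(z in @polydisk n)
     lne (cabs (meval (fun i => toC (tnth z i)) F))%:E)%E.

(* x_1, ..., x_m are the variables of index 0, ..., m - 1 and u that of index m. *)
Definition Pm_x (m : nat) (j : 'I_m) : mpoly m.+1 R[i] :=
  mpolyX R[i] (mnm1 (widen_ord (leqnSn m) j)).
Definition Pm_u (m : nat) : mpoly m.+1 R[i] := mpolyX R[i] (mnm1 ord_max).

Definition Pm (m : nat) : mpoly m.+1 R[i] :=
  \prod_(j < m) (1 + Pm_x j) + Pm_u m * \prod_(j < m) (1 - Pm_x j).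

Definition q (z : R[i]) : R[i] := (1 - z) / (1 + z).

Definition uniform_on_disk d (T : measurableType d) (P : probability T R)
    (X : {RV P >-> plane R}) : Prop :=
  forall B : set (plane R), measurable B ->
    distribution P X B = (pi^-1%:E * area (B `&` unit_disk))%E.

(* A predicate, because a density is determined only up to a null set. *)
Definition is_density d (T : measurableType d) (P : probability T R)
    (Y : T -> R) (f : R -> R) : Prop :=
  [/\ measurable_fun [set: R] f,
      forall y, 0 <= f y &
      forall B : set R, measurable B ->
        P (Y @^-1` B) = (\int[lebesgue_measure]_(y in B) (f y)%:E)%E].

(* Rintegral returns 0 where the integral diverges, which for integrable f and
   g happens only for y in a null set. *)
Definition convolution (f g : R -> R) (y : R) : R :=
  \int[lebesgue_measure]_t (f t * g (y - t)).

(* The m-fold convolution for 1 <= m; the value at m = 0 is irrelevant. *)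
Definition convolution_pow (f : R -> R) (m : nat) : R -> R :=
  iter m.-1 (convolution f) f.

End areal_mahler.

(* Main.v *)
Require Import Defs.
From HB Require Import structures.
From mathcomp Require Import all_boot all_order all_algebra.
From mathcomp Require Import complex.
From mathcomp Require Import -(notations) mpoly.
From mathcomp Require Import all_classical all_reals all_analysis.
From mathcomp Require Import measurable_realfun.
From mathcomp Require Import ring lra.

(** Jensen's formula on the disk, [\int_D ln |w - u| dA(u) =
    \int_D ln (max |u| |w|) dA(u)], is obtained by doubling: if [z ^ n = -1],
    rotating by [z] turns [ln |w^n - u^n|] into [ln |w^n + u^n|], so the defect
    [\int_D (ln |w^n - u^n| - n ln (max |u| |w|))] is multiplied by 2 when n is.
    It is also bounded, since
    [ln |w^n - u^n|] differs from [n ln (max |u| |w|)] by at most a radial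
    integrable function independent of n; hence it is zero.

    For nonzero a, b the integral over u of
    [ln |a \prod (1 + x_j) + u b \prod (1 - x_j)|] is thus the sum of
    [pi ln |a \prod (1 + x_j)|], which has the mean [pi ln |a|], and of [pi g]
    evaluated at [ln |b / a| + \sum ln |q (x_j)|], where
    [g y = y + (e^(-2y) - 1) / 2] for [y >= 0] and [g y = 0] otherwise.
    Integrating the x_j out one at a time replaces g by its successive averages
    against rho, that is by its average against rho^{*m}.  Each step is made on
    the nonnegative function [C - ln |.|], so that Tonelli applies. *)

Set Implicit Arguments.
Unset Strict Implicit.
Unset Printing Implicit Defensive.

Import Order.TTheory GRing.Theory Num.Theory.
Import numFieldNormedType.Exports.
Local Open Scope classical_set_scope.
Local Open Scope ring_scope.

(** * Transport of integrals along a map whose image law has a density *)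

Section density.
Local Open Scope ereal_scope.
Context d1 d2 (T1 : measurableType d1) (T2 : measurableType d2) (R : realType).
Variables (mu : {measure set T1 -> \bar R}) (nu : {measure set T2 -> \bar R}).
Variables (D : set T1) (E : set T2) (f : T1 -> T2) (r : T2 -> R).
Hypotheses (mD : measurable D) (mE : measurable E).
Hypotheses (mf : measurable_fun [set: T1] f) (mr : measurable_fun [set: T2] r).
Hypothesis r0 : forall y, (0 <= r y)%R.
Hypothesis law : forall B, measurable B ->
  mu (D `&` f @^-1` B) = \int[nu]_(y in E `&` B) (r y)%:E.

Import HBNNSimple.

(** [law] is the case of indicators; simple functions follow by linearity and the rest by monotone
    convergence. A constant [r] serves for changes of variable, a general one for the density
    [rho]. *)
Lemma ge0_integral_law (h : T2 -> \bar R) : measurable_fun [set: T2] h ->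
  (forall y, 0 <= h y) ->
  \int[mu]_(x in D) h (f x) = \int[nu]_(y in E) (h y * (r y)%:E).
Proof.
move=> mh h0.
pose h_ := nnsfun_approx measurableT mh.
have hcvg y : (h_ n y)%:E @[n --> \oo] --> h y by exact: cvg_nnsfun_approx.
have mhf (g : T2 -> \bar R) : measurable_fun setT g ->
    measurable_fun D (fun x => g (f x)).
  by move=> mg; apply: measurable_funTS; exact: measurableT_comp.
have mhn n : measurable_fun setT (fun y => (h_ n y)%:E).
  exact/measurable_EFinP/measurable_funP.
have mhr (g : T2 -> \bar R) : measurable_fun setT g ->
    measurable_fun E (fun y => g y * (r y)%:E).
  move=> mg; apply: measurable_funTS; apply: emeasurable_funM => //.
  exact/measurable_EFinP.
transitivity (limn (fun n => \int[mu]_(x in D) (h_ n (f x))%:E)).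
  rewrite -monotone_convergence//.
  - by apply: eq_integral => y _; apply/esym/cvg_lim => //; exact: hcvg.
  - by move=> n; exact: (mhf _ (mhn n)).
  - by move=> n y _; rewrite lee_fin.
  - by move=> y _ m n mn; rewrite lee_fin; exact/lefP/nd_nnsfun_approx.
transitivity (limn (fun n => \int[nu]_(y in E) ((h_ n y)%:E * (r y)%:E))); last first.
  rewrite -monotone_convergence//.
  - apply: eq_integral => y _; apply/cvg_lim => //.
    by apply: cvgeZr => //; exact: hcvg.
  - by move=> n; exact: (mhr _ (mhn n)).
  - by move=> n y _; rewrite mule_ge0// lee_fin.
  - by move=> y _ m n mn; rewrite lee_wpmul2r ?lee_fin//; exact/lefP/nd_nnsfun_approx.
congr (limn _); apply/funext => n.
have mpre k : measurable (h_ n @^-1` [set k]).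
  by rewrite -[X in measurable X]setTI; exact: measurable_funP.
under eq_integral do rewrite fimfunE -fsumEFin//.
rewrite ge0_integral_fsum//; last 2 first.
- move=> k; apply: (mhf (fun y => (k * \1_(h_ n @^-1` [set k]) y)%:E)).
  by apply/measurable_EFinP; exact: measurable_funM.
- by move=> k x _; rewrite EFinM nnfun_muleindic_ge0.
transitivity (\int[nu]_(y in E) (\sum_(k \in range (h_ n))
    (k * \1_(h_ n @^-1` [set k]) y)%:E * (r y)%:E)); last first.
  under eq_integral => y _.
    rewrite -ge0_mule_fsuml => [|k]; last exact: nnfun_muleindic_ge0.
    rewrite fsumEFin// -(fimfunE _ y); over.
  by [].
rewrite ge0_integral_fsum//; last 2 first.
- move=> k; apply: (mhr (fun y => (k * \1_(h_ n @^-1` [set k]) y)%:E)).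
  by apply/measurable_EFinP; exact: measurable_funM.
- by move=> k y _; rewrite mule_ge0 ?lee_fin// -lee_fin nnfun_muleindic_ge0.
apply: eq_fsbigr => k /[1!inE] -[y0 _ hk].
have k0 : (0 <= k)%R by rewrite -hk.
under eq_integral do rewrite EFinM.
rewrite ge0_integralZl_EFin//; last first.
  by apply: (mhf (fun y => (\1_(h_ n @^-1` [set k]) y)%:E)); exact/measurable_EFinP.
under [RHS]eq_integral do rewrite EFinM -muleA.
rewrite ge0_integralZl_EFin//; last 2 first.
- by move=> y _; rewrite mule_ge0// ?lee_fin.
- by apply: (mhr (fun y => (\1_(h_ n @^-1` [set k]) y)%:E)); exact/measurable_EFinP.
congr (_ * _).
transitivity (mu (D `&` f @^-1` (h_ n @^-1` [set k]))).
  rewrite (eq_integral (fun x => (\1_(f @^-1` (h_ n @^-1` [set k])) x)%:E)).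
    rewrite integral_indic//; first by rewrite setIC.
    by rewrite -[X in measurable X]setTI; exact: mf.
  by move=> x _; rewrite !indicE; congr (_%:R%:E); apply/idP/idP; rewrite !inE.
rewrite law// integral_mkcondr.
by apply: eq_integral => y _; rewrite epatch_indic muleC.
Qed.

End density.

(** * Affine substitutions on the line *)

Section lebesgue_affine.
Local Open Scope ereal_scope.
Context (R : realType).
Local Notation leb := (@lebesgue_measure R).

(** The rescaled image measure gives every interval []u, v]] its length, so uniqueness of Lebesgue
    measure applies. *)
Lemma lebesgue_measure_affine (c b : R) (A : set (measurableTypeR R)) :
  (0 < c)%R -> measurable A ->
  leb A = c%:E * leb ((fun x : R => c * x + b)%R @^-1` A).
Proof.
move=> c0 mA.
have mf : measurable_fun [set: measurableTypeR R]
    ((fun x => c * x + b)%R : measurableTypeR R -> measurableTypeR R).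
  by apply: measurable_funD => //; exact: measurable_funM.
pose mF := @isMeasurableFun.Build _ _ _ _ _ mf.
pose F : {mfun _ >-> _} := HB.pack
  ((fun x => c * x + b)%R : measurableTypeR R -> measurableTypeR R) mF.
rewrite (@lebesgue_measure_unique _
  (mscale (NngNum (ltW c0)) (pushforward leb F)))//.
move=> _ [[u v]] _ <-.
transitivity (c%:E * leb `](u - b) / c, (v - b) / c]%classic%R); last first.
  congr (_ * leb _).
  apply/seteqP; split => x /=; rewrite !in_itv/= ltr_pdivrMr// ler_pdivlMr//;
    by rewrite [(x * c)%R]mulrC ltrBlDr lerBrDr.
rewrite !lebesgue_measure_itv/= !lte_fin ltr_pM2r ?invr_gt0//.
rewrite ltrD2r; case: ifPn => _; last by rewrite mule0.
by rewrite -!EFinB -EFinM; congr (_%:E); field; rewrite gt_eqF.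
Qed.

(** The image of Lebesgue measure under the affine map has the constant density [c^-1]. *)
Lemma ge0_integral_affine (c b : R) (h : measurableTypeR R -> \bar R) :
  (0 < c)%R -> measurable_fun [set: measurableTypeR R] h -> (forall x, 0 <= h x) ->
  c%:E * \int[leb]_x h (c * x + b)%R = \int[leb]_x h x.
Proof.
move=> c0 mh h0.
have mf : measurable_fun [set: measurableTypeR R]
    ((fun x => c * x + b)%R : measurableTypeR R -> measurableTypeR R).
  by apply: measurable_funD => //; exact: measurable_funM.
rewrite (@ge0_integral_law _ _ _ _ _ leb leb setT setT _ (cst c^-1%R) _ _ mf)//=.
- under eq_integral do rewrite muleC.
  rewrite ge0_integralZl_EFin// ?invr_ge0 ?ltW//.
  by rewrite muleA -EFinM divff ?mul1e// gt_eqF.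
- by move=> _; rewrite invr_ge0 ltW.
- move=> B mB; rewrite !setTI integral_cst//= (lebesgue_measure_affine b c0 mB).
  by rewrite muleA -EFinM mulVf ?mul1e// gt_eqF.
Qed.

Lemma ge0_integral_shift (b : R) (h : measurableTypeR R -> \bar R) :
  measurable_fun [set: measurableTypeR R] h -> (forall x, 0 <= h x) ->
  \int[leb]_x h (x + b)%R = \int[leb]_x h x.
Proof.
move=> mh h0; rewrite -[RHS](@ge0_integral_affine 1 b)// mul1e.
by apply: eq_integral => x _; rewrite mul1r.
Qed.

Lemma ge0_integral_opp (h : measurableTypeR R -> \bar R) :
  measurable_fun [set: measurableTypeR R] h -> (forall x, 0 <= h x) ->
  \int[leb]_x h (- x)%R = \int[leb]_x h x.
Proof.
move=> mh h0; rewrite (@ge0_integral_law _ _ _ _ _ leb leb setT setT -%R (cst 1%R))//=.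
- by apply: eq_integral => x _; rewrite mule1.
- move=> B mB; rewrite !setTI integral_cst//= mul1e.
  exact: lebesgue_measureN.
Qed.

End lebesgue_affine.

(** * Planar area under shears, rotations and dilations *)

Section area_invariance.
Local Open Scope ereal_scope.
Context (R : realType).
Local Notation leb := (@lebesgue_measure R).
Local Notation area := (@area R).

Lemma area_fubini1 (h : plane R -> \bar R) :
  measurable_fun [set: plane R] h -> (forall z, 0 <= h z) ->
  \int[area]_z h z = \int[leb]_x \int[leb]_y h (x, y).
Proof. by move=> mh h0; exact: (@fubini_tonelli1 _ _ _ _ R leb leb). Qed.

Lemma area_fubini2 (h : plane R -> \bar R) :
  measurable_fun [set: plane R] h -> (forall z, 0 <= h z) ->
  \int[area]_z h z = \int[leb]_y \int[leb]_x h (x, y).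
Proof. by move=> mh h0; exact: (@fubini_tonelli2 _ _ _ _ R leb leb). Qed.

(** Phrased with integrals rather than measures of sets, so that composition is immediate. *)
Definition area_preserving (f : plane R -> plane R) : Prop :=
  measurable_fun [set: plane R] f /\
  forall h : plane R -> \bar R, measurable_fun [set: plane R] h ->
    (forall z, 0 <= h z) -> \int[area]_z h (f z) = \int[area]_z h z.

Lemma area_preserving_comp f g :
  area_preserving f -> area_preserving g -> area_preserving (f \o g).
Proof.
move=> [mf af] [mg ag]; split; first exact: measurableT_comp.
by move=> h mh h0; rewrite -[RHS]af//; apply: (ag (h \o f)) => [|z];
  [exact: measurableT_comp|exact: h0].
Qed.

(** Tonelli with [x] innermost: for a fixed second coordinate the shear is a translation. *)
Lemma area_preserving_hshear (a : R) :
  area_preserving (fun z => (z.1 + a * z.2, z.2)%R : plane R).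
Proof.
have mf : measurable_fun [set: plane R] (fun z => (z.1 + a * z.2, z.2)%R : plane R).
  apply: measurable_fun_pair => //.
  by apply: measurable_funD => //; exact: measurable_funM.
split=> // h mh h0.
rewrite (area_fubini2 mh h0) area_fubini2//=; last exact: measurableT_comp.
apply: eq_integral => y _.
rewrite (@ge0_integral_shift _ (a * y)%R (fun x => h (x, y)))//.
by apply: measurableT_comp => //; exact: measurable_fun_pair.
Qed.

Lemma area_preserving_vshear (a : R) :
  area_preserving (fun z => (z.1, z.2 + a * z.1)%R : plane R).
Proof.
have mf : measurable_fun [set: plane R] (fun z => (z.1, z.2 + a * z.1)%R : plane R).
  apply: measurable_fun_pair => //.
  by apply: measurable_funD => //; exact: measurable_funM.
split=> // h mh h0.
rewrite (area_fubini1 mh h0) area_fubini1//=; last exact: measurableT_comp.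
apply: eq_integral => x _.
rewrite (@ge0_integral_shift _ (a * x)%R (fun y => h (x, y)))//.
by apply: measurableT_comp => //; exact: measurable_fun_pair.
Qed.

Definition mulC (w : R[i]) (z : plane R) : plane R :=
  (complex.Re w * z.1 - complex.Im w * z.2,
   complex.Im w * z.1 + complex.Re w * z.2)%R.

Lemma toC_mulC (w : R[i]) (z : plane R) : toC (mulC w z) = (w * toC z)%R.
Proof.
case: w => a b; rewrite /toC /mulC; simpc => /=.
by rewrite [(b * _ + _)%R]addrC.
Qed.

(** A rotation other than the half turn is a product of three shears; the half turn is the square of
    a quarter turn. *)
Lemma area_preserving_mulC (w : R[i]) : cabs w = 1%R -> area_preserving (mulC w).
Proof.
have rot a b : (a ^+ 2 + b ^+ 2 = 1 -> a != -1 -> area_preserving (mulC (a +i* b)%C))%R.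
  move=> ab1 aN1; have a1 : (1 + a != 0)%R by rewrite addrC addr_eq0.
  (* With [a] and [b] the cosine and sine of the angle, [t] is minus the tangent of half the
     angle. *)
  pose t := (- (b / (1 + a)))%R.
  rewrite (_ : mulC _ = (fun z => (z.1 + t * z.2, z.2)%R : plane R) \o
    ((fun z => (z.1, z.2 + b * z.1)%R : plane R) \o
     (fun z => (z.1 + t * z.2, z.2)%R : plane R))).
    apply: area_preserving_comp; first exact: area_preserving_hshear.
    by apply: area_preserving_comp; [exact: area_preserving_vshear|
      exact: area_preserving_hshear].
  have tb : (t * b = a - 1)%R.
    apply: (mulIf a1); rewrite /t; transitivity (- b ^+ 2)%R; first by field.
    have -> : (b ^+ 2 = 1 - a ^+ 2)%R by rewrite -ab1 addrAC subrr add0r.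
    by ring.
  have tt : (t * (1 + a) = - b)%R by rewrite /t; field.
  apply/funext => -[x y]; rewrite /mulC/=; congr pair.
    transitivity (x + t * y + (t * b) * x + t * y + (t * b) * (t * y))%R; last ring.
    transitivity (a * x - b * y)%R => //.
    by rewrite tb -[b]opprK -tt; ring.
  transitivity (y + b * x + (t * b) * y)%R; last ring.
  by rewrite tb; ring.
case: w => a b; rewrite /cabs/= => /(congr1 (fun x => x ^+ 2)%R).
rewrite sqr_sqrtr ?addr_ge0 ?sqr_ge0// expr1n => ab1.
have [aN1|] := eqVneq a (-1)%R; last exact: rot.
have b0 : b = 0%R.
  by apply/eqP; rewrite -sqrf_eq0; apply/eqP; move: ab1; rewrite aN1; lra.
have rot_i : area_preserving (mulC (0%R +i* 1%R)%C).
  by apply: rot; rewrite ?expr0n ?add0r ?expr1n// eq_sym oppr_eq0 oner_eq0.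
rewrite (_ : mulC _ = mulC (0%R +i* 1%R)%C \o mulC (0%R +i* 1%R)%C).
  exact: area_preserving_comp.
by apply/funext => -[x y]; rewrite /mulC/= aN1 b0; congr pair; ring.
Qed.

(** One affine substitution per coordinate, each contributing a factor [c]. *)
Lemma ge0_integral_area_dilate (c : R) (h : plane R -> \bar R) : (0 < c)%R ->
  measurable_fun [set: plane R] h -> (forall z, 0 <= h z) ->
  (c ^+ 2)%:E * \int[area]_z h (c * z.1, c * z.2)%R = \int[area]_z h z.
Proof.
move=> c0 mh h0.
have mf : measurable_fun [set: plane R] (fun z => (c * z.1, c * z.2)%R : plane R).
  by apply: measurable_fun_pair; exact: measurable_funM.
have mhf := measurableT_comp mh mf.
rewrite (area_fubini1 mh h0) area_fubini1//=.
rewrite -(@ge0_integral_affine _ c 0 (fun x => \int[leb]_y h (x, y)))//; last 2 first.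
- exact: (@measurable_fun_fubini_tonelli_F _ _ _ _ R leb h mh h0).
- by move=> x; exact: integral_ge0.
rewrite expr2 EFinM -muleA; congr (_ * _).
rewrite -ge0_integralZl_EFin//; last 3 first.
- by move=> x _; exact: integral_ge0.
- exact: (@measurable_fun_fubini_tonelli_F _ _ _ _ R leb _ mhf (fun z => h0 _)).
- exact: ltW.
apply: eq_integral => x _; rewrite addr0.
rewrite -(@ge0_integral_affine _ c 0 (fun y => h (c * x, y)%R))//.
  by congr (_ * _); apply: eq_integral => y _; rewrite addr0.
by apply: measurableT_comp => //; exact: measurable_fun_pair.
Qed.

End area_invariance.

(** * The law of the squared modulus on the disk *)

Section radial_law.
Local Open Scope ereal_scope.
Context (R : realType).
Local Notation leb := (@lebesgue_measure R).
Local Notation area := (@area R).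

(** The squared modulus is preferred to the modulus because its law under area has the constant
    density [pi] on the nonnegative half-line. *)
Definition normsq (z : plane R) : measurableTypeR R := (z.1 ^+ 2 + z.2 ^+ 2)%R.

Lemma normsqE z : normsq z = (cabs (toC z) ^+ 2)%R.
Proof. by rewrite /cabs/= sqr_sqrtr// addr_ge0// sqr_ge0. Qed.

Lemma normsq_ge0 z : (0 <= normsq z)%R.
Proof. by rewrite addr_ge0// sqr_ge0. Qed.

Lemma measurable_normsq : measurable_fun [set: plane R] normsq.
Proof. by apply: measurable_funD; exact: measurable_funX. Qed.

Lemma unit_diskE : @unit_disk R = normsq @^-1` `[0%R, 1%R[.
Proof.
apply/seteqP; split => z; rewrite /unit_disk/= in_itv/= normsq_ge0/= normsqE;
  by rewrite expr_lt1// sqrtr_ge0.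
Qed.

Lemma measurable_normsq_preimage (B : set (measurableTypeR R)) :
  measurable B -> measurable (normsq @^-1` B).
Proof.
by move=> mB; rewrite -[X in measurable X]setTI; exact: measurable_normsq.
Qed.

Lemma measurable_normsq_itv (i : interval R) : measurable (normsq @^-1` [set` i]).
Proof. by apply: measurable_normsq_preimage; exact: measurable_itv. Qed.

Lemma measurable_unit_disk : measurable (@unit_disk R).
Proof. by rewrite unit_diskE; exact: measurable_normsq_itv. Qed.

(** This value is not computed from coordinates: the existence of a uniform variable on the disk
    forces it, see [area_unit_disk]. *)
Hypothesis area_disk : area (@unit_disk R) = pi%:E.

(** Dilation by [Num.sqrt b] carries the unit disk onto this one and multiplies areas by [b]. *)
Let area_lt (b : R) : (0 <= b)%R ->
  area (normsq @^-1` `]-oo, b[) = (b * pi)%:E.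
Proof.
rewrite le_eqVlt => /predU1P[<-|b0].
  rewrite mul0r (_ : _ @^-1` _ = set0) ?measure0//.
  by apply/seteqP; split => z //=; rewrite in_itv/= ltNge normsq_ge0.
have mI (c : R) : measurable_fun [set: plane R]
    (fun z => (\1_(normsq @^-1` `]-oo, c[) z)%:E : \bar R).
  by apply/measurable_EFinP/measurable_indic; exact: measurable_normsq_itv.
rewrite -[_ @^-1` _]setIT -integral_indic//; last exact: measurable_normsq_itv.
rewrite -(@ge0_integral_area_dilate R (Num.sqrt b) _ _ (mI b)) ?sqrtr_gt0//.
rewrite sqr_sqrtr ?ltW//.
rewrite EFinM -area_disk; congr (_ * _).
rewrite -[@unit_disk R]setIT -integral_indic//; last exact: measurable_unit_disk.
apply: eq_integral => z _ /=; rewrite !indicE; congr (nat_of_bool _)%:R%:E.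
apply/idP/idP; rewrite !inE unit_diskE/= !in_itv/= normsq_ge0/=;
  rewrite /normsq/= !exprMn sqr_sqrtr ?ltW// -mulrDr;
  by rewrite -ltr_pdivlMl// mulVf ?gt_eqF.
Qed.

Let area_le (b : R) : (0 <= b)%R ->
  area (normsq @^-1` `]-oo, b]) = (b * pi)%:E.
Proof.
move=> b0; apply/eqP; rewrite eq_le; apply/andP; split.
  apply/lee_addgt0Pr => e e0.
  (* A margin [e / pi] in the squared radius costs exactly [e] in area. *)
  have pe0 : (0 < e / pi)%R by rewrite divr_gt0// pi_gt0.
  have be0 : (0 <= b + e / pi)%R by rewrite addr_ge0// ltW.
  have <- : area (normsq @^-1` `]-oo, (b + e / pi)%R[) = (b * pi)%:E + e%:E.
    by rewrite area_lt// -EFinD mulrDl divfK// gt_eqF// pi_gt0.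
  apply: le_measure; rewrite ?inE; try exact: measurable_normsq_itv.
  by move=> z /=; rewrite !in_itv/= => /le_lt_trans; apply; rewrite ltrDl.
rewrite -area_lt//.
apply: le_measure; rewrite ?inE; try exact: measurable_normsq_itv.
by move=> z /=; rewrite !in_itv/= => /ltW.
Qed.

Let area_ocitv (a b : R) : (0 <= a)%R -> (a <= b)%R ->
  area (normsq @^-1` `]a, b]) = ((b - a) * pi)%:E.
Proof.
move=> a0 ab.
have : area (normsq @^-1` `]-oo, b]) =
    area (normsq @^-1` `]-oo, a]) + area (normsq @^-1` `]a, b]).
  rewrite -measureU; try exact: measurable_normsq_itv.
    congr (area _); apply/seteqP; split => z /=; rewrite !in_itv/=.
      by move=> ->; rewrite andbT; case: leP; [left|right].
    by case=> [/le_trans|/andP[]//]; exact.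
  apply/seteqP; split => z //= []; rewrite !in_itv/= => za /andP[].
  by rewrite ltNge za.
rewrite !area_le ?(le_trans a0)// mulrBl EFinB => ->.
by rewrite addeAC subee// add0e.
Qed.

Lemma area_normsq (B : set (measurableTypeR R)) : measurable B ->
  area (@unit_disk R `&` normsq @^-1` B) = \int[leb]_(t in `[0%R, 1%R[ `&` B) pi%:E.
Proof.
move=> mB.
have pi0 : (0 <= (pi : R)^-1)%R by rewrite invr_ge0 pi_ge0.
have mneg : measurable (`]-oo, 0%R[%classic : set (measurableTypeR R)).
  exact: measurable_itv.
(* The image of area, divided by [pi], reproduces Lebesgue measure on the nonnegative half-line
   only. Adding Lebesgue measure restricted to the negative half-line gives a measure that agrees
   with [leb] on all intervals []a, b]], hence everywhere. *)
pose nu := measure_add (mscale (NngNum pi0) (pushforward area normsq))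
  (mrestr leb mneg).
have nuE A : nu measurable_normsq A = (pi^-1)%:E * area (normsq @^-1` A) + leb (A `&` `]-oo, 0%R[).
  by rewrite /nu measure_addE.
have leb_nu A : measurable A -> leb A = nu measurable_normsq A.
  apply: lebesgue_measure_unique => _ [[a b]] _ <-.
  rewrite -[RHS]/(nu measurable_normsq _) nuE.
  have [ba|ab] := ltP b a.
    rewrite (_ : `]a, b]%classic = set0); last first.
      by apply/seteqP; split => x //=; rewrite in_itv/=; lra.
    by rewrite preimage_set0 set0I !measure0 mule0 adde0.
  have [a0|a0] := leP 0%R a.
    rewrite area_ocitv// lebesgue_measure_itv/= lte_fin.
    rewrite (_ : _ `&` _ = set0); last first.
      by apply/seteqP; split => x //=; rewrite !in_itv/=; lra.
    rewrite measure0 adde0 -EFinM mulrCA mulVf ?gt_eqF ?pi_gt0// mulr1.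
    by move: ab; rewrite le_eqVlt => /predU1P[->|->]//; rewrite ltxx subrr.
  have [b0|b0] := leP 0%R b.
    rewrite (_ : normsq @^-1` _ = normsq @^-1` `]-oo, b]); last first.
      apply/seteqP; split => x /=; rewrite !in_itv/=; first by case/andP.
      by rewrite (lt_le_trans a0)// normsq_ge0.
    rewrite area_le// -EFinM.
    rewrite (_ : _ `&` _ = `]a, 0%R[%classic); last first.
      by apply/seteqP; split => x //=; rewrite !in_itv/=; lra.
    rewrite !lebesgue_measure_itv/= !lte_fin.
    rewrite a0 (lt_le_trans a0 b0) mulrCA mulVf ?gt_eqF ?pi_gt0// mulr1.
    by rewrite add0e.
  rewrite (_ : normsq @^-1` _ = set0); last first.
    apply/seteqP; split => x //=; rewrite in_itv/= => /andP[_ xb].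
    by have := normsq_ge0 x; rewrite leNgt (le_lt_trans xb).
  rewrite measure0 mule0 add0e; congr (leb _).
  by apply/seteqP; split => x //=; rewrite !in_itv/=; lra.
rewrite integral_cst/=; last exact: measurableI.
rewrite unit_diskE -preimage_setI leb_nu; last exact: measurableI.
rewrite nuE -setIA (setIC B) setIA (_ : _ `&` `]-oo, _[%classic = set0); last first.
  by apply/seteqP; split => x //= -[]; rewrite !in_itv/=; lra.
by rewrite set0I measure0 adde0 muleA -EFinM divff ?mul1e// gt_eqF// pi_gt0.
Qed.

Lemma ge0_integral_disk_normsq (h : measurableTypeR R -> \bar R) :
  measurable_fun [set: measurableTypeR R] h -> (forall t, 0 <= h t) ->
  \int[area]_(z in @unit_disk R) h (normsq z) =
  pi%:E * \int[leb]_(t in `[0%R, 1%R[) h t.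
Proof.
move=> mh h0.
rewrite (@ge0_integral_law _ _ _ _ _ area leb (@unit_disk R) `[0%R, 1%R[%classic
  normsq (cst pi))//.
- under eq_integral do rewrite muleC.
  by rewrite ge0_integralZl_EFin ?pi_ge0//; exact: measurable_funTS.
- exact: measurable_unit_disk.
- exact: measurable_normsq.
- by move=> y; exact: pi_ge0.
- exact: area_normsq.
Qed.

End radial_law.

(** * One-variable logarithmic integrals *)

Section log_integrals.
Local Open Scope ereal_scope.
Context (R : realType).
Local Notation leb := (@lebesgue_measure R).

Lemma integral_Nln_itv (e : R) : (0 < e < 1)%R ->
  \int[leb]_(t in `[e, 1%R]) (- ln t)%:E = (1 - e + e * ln e)%:E.
Proof.
move=> /andP[e0 e1].
pose F (x : R) := (x - x * ln x)%R.
have dF (x : R) : (0 < x)%R -> is_derive x 1%R F (- ln x)%R.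
  move=> x0; have dln := is_derive1_ln x0.
  apply: is_derive_eq; rewrite /GRing.scale/= mulr1 divff ?gt_eqF//; ring.
have cF (x : R) : (0 < x)%R -> {for x, continuous F}.
  by move=> x0; apply/differentiable_continuous/derivable1_diffP; have [] := dF _ x0.
rewrite (@continuous_FTC2 _ (fun t => - ln t)%R F)//.
- by rewrite /F ln1 -EFinB; congr (_%:E); ring.
- apply/continuous_in_subspaceT => x; rewrite inE/= in_itv/= => /andP[ex _].
  by apply: continuousN; apply: continuous_ln; exact: lt_le_trans ex.
- split.
  + move=> x; rewrite in_itv/= => /andP[ex _].
    by have [] := dF _ (lt_trans e0 ex).
  + exact/cvg_at_right_filter/cF.
  + exact/cvg_at_left_filter/cF.
- move=> x; rewrite in_itv/= => /andP[ex _]; rewrite derive1E.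
  by have [_ ->] := dF _ (lt_trans e0 ex).
Qed.

(** The interval is exhausted by compact ones on which the integral is at most 1. *)
Lemma integral_Nln_lty : \int[leb]_(t in `]0%R, 1%R]) (- ln t)%:E < +oo.
Proof.
(* The shift by 2 keeps the left endpoint strictly below 1, as [integral_Nln_itv] requires. *)
pose I n : set R := `[(n.+2%:R^-1 : R)%R, 1%R]%classic.
have -> : `]0%R, 1%R]%classic = \bigcup_n I n.
  apply/seteqP; split => x /=.
    rewrite in_itv/= => /andP[x0 x1].
    exists (Num.truncn x^-1) => //; rewrite /I/= in_itv/= x1 andbT.
    rewrite invf_ple ?posrE//; apply/ltW/(lt_trans (truncnS_gt _)).
    by rewrite ltr_nat.
  move=> [n _]; rewrite /I/= !in_itv/= => /andP[nx ->]; rewrite andbT.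
  by apply: lt_le_trans nx; rewrite invr_gt0.
have mNln (D : set R) : measurable_fun D (fun t => (- ln t)%:E).
  apply/measurable_EFinP/measurableT_comp => //.
  by apply: measurable_funTS; exact: measurable_ln.
apply: (@le_lt_trans _ _ 1); last exact: ltry.
have cI : \int[leb]_(t in I n) (- ln t)%:E @[n --> \oo] -->
    \int[leb]_(t in \bigcup_n I n) (- ln t)%:E.
  apply: ge0_nondecreasing_set_cvg_integral.
  - apply/nondecreasing_seqP => n; apply/subsetPset => x.
    rewrite /I/= !in_itv/= => /andP[nx ->]; rewrite andbT.
    by apply: le_trans nx; rewrite lef_pV2 ?posrE// ler_nat.
  - by move=> n; exact: measurable_itv.
  - by move=> n; exact: mNln.
  - move=> n x; rewrite /I/= in_itv/= => /andP[_ x1].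
    by rewrite lee_fin oppr_ge0 ln_le0.
rewrite -(cvg_lim _ cI)//; apply: lime_le; first exact: (cvgP _ cI).
apply: nearW => n.
have n01 : (0 < (n.+2%:R^-1 : R) < 1)%R.
  by rewrite invr_gt0 ltr0n invf_lt1// ltr1n.
rewrite integral_Nln_itv// lee_fin.
have : ((n.+2%:R^-1 : R) * ln n.+2%:R^-1 <= 0)%R.
  by rewrite nmulr_lle0 ?invr_ge0// ln_lt0.
move: n01 => /andP[]; move: (n.+2%:R^-1)%R => e; lra.
Qed.

(* Truncating the logarithm to its singularity makes the integral over the
   whole line finite, so that it can be translated. *)
Lemma integral_log_pole (a : R) :
  \int[leb]_t (Num.max 0 (- ln `|t - a|))%:E < +oo.
Proof.
pose f : measurableTypeR R -> \bar R := (fun t => (- ln t)%:E) \_ `]0%R, 1%R].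
have mf : measurable_fun [set: measurableTypeR R] f.
  apply: (iffLR (measurable_restrictT _ _)); first exact: measurable_itv.
  by apply: measurable_funTS; apply/measurable_EFinP/measurableT_comp.
have f0 t : 0 <= f t.
  rewrite /f patchE; case: ifPn => //; rewrite inE/= in_itv/= => /andP[_ t1].
  by rewrite lee_fin oppr_ge0 ln_le0.
have mfN : measurable_fun [set: measurableTypeR R] (fun t => f (- t)%R).
  by apply: measurableT_comp.
rewrite (@ge0_integral_shift _ (- a)%R (fun t => (Num.max 0 (- ln `|t|))%:E)); last 2 first.
- apply/measurable_EFinP; apply: measurable_maxr => //.
  apply: measurableT_comp => //; apply: (measurableT_comp (@measurable_ln R)).
  exact: normr_measurable.
- by move=> t; rewrite lee_fin le_max lexx.
(* The two half-lines are mirror images; at 0 both sides vanish because [ln 0 = 0]. *)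
rewrite (eq_integral (fun t => f t + f (- t)%R)); last first.
  move=> t _; rewrite /f !patchE !mem_setE !in_itv/=.
  have [t0|t0|<-] := ltgtP 0%R t.
  - rewrite (gtr0_norm t0) (_ : (0 < - t)%R = false) ?adde0/=; last lra.
    case: leP => t1; first by rewrite max_r// oppr_ge0 ln_le0.
    by rewrite max_l// oppr_le0 ln_ge0// ltW.
  - rewrite (ltr0_norm t0) (_ : (0 < - t)%R) ?add0e/=; last lra.
    case: leP => t1; first by rewrite max_r// oppr_ge0 ln_le0.
    by rewrite max_l// oppr_le0 ln_ge0// ltW.
  - by rewrite normr0 oppr0 ltxx/= ln0// oppr0 maxxx adde0.
rewrite ge0_integralD//= (ge0_integral_opp mf f0).
have foo : \int[leb]_t f t < +oo.
  by rewrite /f -integral_mkcond; exact: integral_Nln_lty.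
by rewrite lte_add_pinfty.
Qed.

(** With [t = |u|^2] and [a = |w|^2], this is twice the amount by which the mean of
    [ln (max |u| |w|)] over the disk falls below [ln (max 1 |w|)]. The term [(e^(-2y) - 1) / 2] of
    the theorem comes from here. *)
Lemma integral_Nln_max (a : R) : (0 < a)%R ->
  \int[leb]_(t in `[0%R, 1%R[) (ln (Num.max 1 a) - ln (Num.max t a))%:E =
  (if 1 <= a then 0 else 1 - a)%:E.
Proof.
move=> a0; have [a1|a1] := leP 1%R a.
  apply: integral0_eq => t /=; rewrite in_itv/= => /andP[_ t1].
  by rewrite !max_r ?subrr// (le_trans (ltW t1)).
rewrite ln1.
have mf (D : set (measurableTypeR R)) :
    measurable_fun D (fun t => (0 - ln (Num.max t a))%:E).
  apply: measurable_funTS; apply/measurable_EFinP; apply: measurable_funB => //.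
  by apply: measurableT_comp => //; exact: measurable_maxr.
(* Below [a] the integrand is the constant [- ln a], above it is [- ln t]; the terms [a * ln a]
   cancel. *)
have -> : `[0%R, 1%R[%classic = `[0%R, a[%classic `|` `[a, 1%R[%classic :> set R.
  by apply/seteqP; split => x /=; rewrite !in_itv/=; lra.
rewrite ge0_integral_setU//=; last 2 first.
- move=> x; rewrite !in_itv/= => x01; rewrite lee_fin subr_ge0 ln_le0//.
  by rewrite ge_max; lra.
- by apply/disj_setPS => x /=; rewrite !in_itv/=; lra.
rewrite (eq_integral (cst (- ln a)%:E)); last first.
  by move=> x; rewrite inE/= in_itv/= sub0r => /andP[_ /ltW xa]; rewrite max_r.
rewrite integral_cst//= lebesgue_measure_itv/= lte_fin a0 sube0.
rewrite integral_itv_bndo_bndc; last exact: mf.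
rewrite (eq_integral (fun t : measurableTypeR R => (- ln t)%:E)); last first.
  by move=> x; rewrite inE/= in_itv/= sub0r => /andP[ax _]; rewrite max_l.
rewrite integral_Nln_itv ?a0// -EFinM -EFinD; congr (_%:E); ring.
Qed.

End log_integrals.

(** * The complex modulus *)

Section complex_modulus.
Context (R : realType).
Implicit Types z w : R[i].

Lemma cabs_ge0 z : 0 <= cabs z.
Proof. by case: z => x y; exact: sqrtr_ge0. Qed.

Lemma cabsM z w : cabs (z * w) = cabs z * cabs w.
Proof. exact: ComplexField.Normc.normcM. Qed.

Lemma cabsV z : cabs z^-1 = (cabs z)^-1.
Proof. exact: ComplexField.Normc.normcV. Qed.

Lemma cabs0 : cabs (0 : R[i]) = 0.
Proof. exact: ComplexField.Normc.normc0. Qed.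

Lemma cabs1 : cabs (1 : R[i]) = 1.
Proof. exact: ComplexField.Normc.normc1. Qed.

Lemma cabsN z : cabs (- z) = cabs z.
Proof. by case: z => x y; rewrite /cabs/= !sqrrN. Qed.

Lemma cabsX z n : cabs (z ^+ n) = cabs z ^+ n.
Proof. by elim: n => [|n ih]; rewrite ?expr0 ?cabs1// !exprS cabsM ih. Qed.

Lemma cabs_eq0 z : (cabs z == 0) = (z == 0).
Proof.
apply/eqP/eqP => [|->]; last exact: cabs0.
exact: ComplexField.Normc.eq0_normc.
Qed.

Lemma cabs_gt0 z : (0 < cabs z) = (z != 0).
Proof. by rewrite lt_neqAle cabs_ge0 andbT eq_sym cabs_eq0. Qed.

Lemma le_cabsD z w : cabs (z + w) <= cabs z + cabs w.
Proof. exact: le_normcD. Qed.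

Lemma le_cabsB z w : `|cabs z - cabs w| <= cabs (z - w).
Proof.
have le z1 z2 : cabs z1 - cabs z2 <= cabs (z1 - z2).
  by rewrite lerBlDr -{1}(subrK z2 z1); exact: le_cabsD.
rewrite ler_norml; apply/andP; split; last exact: le.
by rewrite lerNl opprB -[cabs (z - w)]cabsN opprB le.
Qed.

Lemma exists_unimodular_root (n : nat) : (0 < n)%N ->
  exists2 z : R[i], cabs z = 1 & z ^+ n = -1.
Proof.
move=> n0; exists (n.-root (-1)); last exact: rootCK.
apply/eqP; rewrite -(@pexpr_eq1 _ _ n) ?cabs_ge0// -cabsX rootCK//.
by rewrite cabsN cabs1.
Qed.

End complex_modulus.

(** * Measurability of complex-valued functions *)

Section measurable_complex.
Context d (T : measurableType d) (R : realType).
Implicit Types f g : T -> R[i].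

(* R[i] has no measurable structure. *)
Definition cmeasurable f : Prop :=
  measurable_fun [set: T] (fun x => complex.Re (f x) : R) /\
  measurable_fun [set: T] (fun x => complex.Im (f x) : R).

Lemma cmeasurable_cst (c : R[i]) : cmeasurable (fun=> c).
Proof. by split; exact: measurable_cst. Qed.

Lemma cmeasurable_toC (f : T -> plane R) :
  measurable_fun [set: T] f -> cmeasurable (fun x => toC (f x)).
Proof. by move=> mf; split; exact: (measurableT_comp _ mf). Qed.

Lemma cmeasurableD f g :
  cmeasurable f -> cmeasurable g -> cmeasurable (fun x => f x + g x).
Proof.
move=> [f1 f2] [g1 g2]; split.
  under eq_fun do rewrite raddfD.
  exact: measurable_funD.
under eq_fun do rewrite raddfD.
exact: measurable_funD.
Qed.

Lemma cmeasurableM f g :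
  cmeasurable f -> cmeasurable g -> cmeasurable (fun x => f x * g x).
Proof.
move=> [f1 f2] [g1 g2]; split.
  rewrite (_ : (fun x => _) = (fun x => complex.Re (f x) * complex.Re (g x) -
    complex.Im (f x) * complex.Im (g x))).
    by apply: measurable_funB; exact: measurable_funM.
  by apply/funext => x; case: (f x) => a b; case: (g x).
rewrite (_ : (fun x => _) = (fun x => complex.Re (f x) * complex.Im (g x) +
  complex.Im (f x) * complex.Re (g x))).
  by apply: measurable_funD; exact: measurable_funM.
by apply/funext => x; case: (f x) => a b; case: (g x).
Qed.

Lemma cmeasurableB f g :
  cmeasurable f -> cmeasurable g -> cmeasurable (fun x => f x - g x).
Proof.
move=> mf mg; under eq_fun do rewrite -mulN1r.
by apply: cmeasurableD => //; apply: cmeasurableM => //; exact: cmeasurable_cst.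
Qed.

Lemma cmeasurableX f n : cmeasurable f -> cmeasurable (fun x => f x ^+ n).
Proof.
move=> mf; elim: n => [|n ih]; first exact: cmeasurable_cst.
by under eq_fun do rewrite exprS; exact: cmeasurableM.
Qed.

Lemma cmeasurable_prod (I : Type) (r : seq I) (P : pred I) (F : I -> T -> R[i]) :
  (forall i, cmeasurable (F i)) -> cmeasurable (fun x => \prod_(i <- r | P i) F i x).
Proof.
move=> mF; elim: r => [|i r ih].
  by under eq_fun do rewrite big_nil; exact: cmeasurable_cst.
under eq_fun do rewrite big_cons.
by case: (P i) => //; exact: cmeasurableM.
Qed.

Lemma measurable_cabs f : cmeasurable f ->
  measurable_fun [set: T] (fun x => cabs (f x)).
Proof.
move=> [f1 f2].
rewrite (_ : (fun x => _) = (fun x =>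
  Num.sqrt (complex.Re (f x) ^+ 2 + complex.Im (f x) ^+ 2))).
  apply: measurableT_comp; first exact: continuous_measurable_fun (@sqrt_continuous R).
  by apply: measurable_funD; exact: measurable_funX.
by apply/funext => x; case: (f x).
Qed.

End measurable_complex.

(** * Comparison of [ln |w^n - u^n|] with [n ln (max |u| |w|)] *)

Section log_distance.
Context (R : realType).

(** For [x < y], [X] is at most [2 y^n] and at least [y^n - x^n >= y^(n-1) (y - x)], where
    [y - x >= (y^2 - x^2) / (2 y)]. Divided by [y^n], both bounds are free of [n]. They are
    expressed through squares because [normsq] is the variable whose law is known. *)
Lemma ln_distance_bound (x y X : R) (n : nat) : 0 <= x -> 0 <= y -> x != y ->
  (0 < n)%N -> `|x ^+ n - y ^+ n| <= X <= x ^+ n + y ^+ n ->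
  `|ln X - n%:R / 2 * ln (Num.max (x ^+ 2) (y ^+ 2))| <=
  ln 2 + ln (Num.max (x ^+ 2) (y ^+ 2)) - ln `|x ^+ 2 - y ^+ 2|.
Proof.
wlog xy : x y / x < y.
  move=> H x0 y0; rewrite neq_lt => /orP[xy|yx].
    by apply: H => //; rewrite lt_eqF.
  rewrite maxC (distrC (x ^+ n)) (distrC (x ^+ 2)) (addrC (x ^+ n)).
  by apply: H => //; rewrite lt_eqF.
move=> x0 _ _ n0 /andP[].
have y0 : 0 < y by exact: le_lt_trans xy.
have le2 : x ^+ 2 <= y ^+ 2 by rewrite ler_pXn2r ?nnegrE// ltW.
have lt2 : x ^+ 2 < y ^+ 2 by rewrite ltr_pXn2r ?nnegrE// ltW.
have len : x ^+ n <= y ^+ n by rewrite ler_pXn2r ?nnegrE// ltW.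
rewrite max_r// !(distrC (x ^+ _)).
rewrite (ger0_norm (x := y ^+ n - _)) ?(ger0_norm (x := y ^+ 2 - _)) ?subr_ge0//.
move=> leX Xle.
have ltn : x ^+ n < y ^+ n by rewrite ltr_pXn2r ?nnegrE// ltW.
have X0 : 0 < X by apply: lt_le_trans leX; rewrite subr_gt0.
have -> : n%:R / 2 * ln (y ^+ 2) = ln (y ^+ n).
  by rewrite !lnXn// -mulr_natr -[_ *+ n]mulr_natr; field.
have d0 : 0 < y ^+ 2 - x ^+ 2 by rewrite subr_gt0.
have yn0 : 0 < y ^+ n by rewrite exprn_gt0.
have y20 : 0 < y ^+ 2 by rewrite exprn_gt0.
rewrite ler_norml; apply/andP; split; last first.
  apply: (@le_trans _ _ (ln 2)).
    rewrite lerBlDr -lnM ?posrE// ler_ln ?posrE ?mulr_gt0//.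
    by apply: le_trans Xle _; rewrite mulr2n mulrDl mul1r lerD2r.
  rewrite -addrA lerDl subr_ge0 ler_ln ?posrE// lerBlDr lerDl.
  by rewrite exprn_ge0.
rewrite lerNl opprB.
have : y ^+ n * (y ^+ 2 - x ^+ 2) <= X * (2 * y ^+ 2).
  apply: (@le_trans _ _ ((y ^+ n - x ^+ n) * (2 * y ^+ 2))); last first.
    by rewrite ler_wpM2r// mulr_ge0// ltW.
  case: n n0 {leX Xle len ltn} yn0 => // n _ _.
  have yn : 0 <= y ^+ n by rewrite exprn_ge0// ltW.
  have xyn : x ^+ n <= y ^+ n by rewrite lerXn2r ?nnegrE// ltW.
  apply: (@le_trans _ _ (y ^+ n * (y - x) * (2 * y ^+ 2))); last first.
    apply: ler_wpM2r; first by rewrite mulr_ge0// ltW.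
    rewrite !exprS mulrBr [_ * y]mulrC lerB//.
    by rewrite [_ * x]mulrC ler_wpM2l.
  rewrite exprS -subr_ge0.
  have -> : y ^+ n * (y - x) * (2 * y ^+ 2) - y * y ^+ n * (y ^+ 2 - x ^+ 2) =
    y ^+ n * y * (y - x) * (y - x) by ring.
  by rewrite !mulr_ge0 ?subr_ge0// ltW.
rewrite -ler_ln ?posrE ?mulr_gt0// !lnM ?posrE ?mulr_gt0//; lra.
Qed.

End log_distance.

(** * The nonnegative function [C - ln |.|] *)

Section cst_sub_lne.
Local Open Scope ereal_scope.
Context d (T : measurableType d) (R : realType).

(** For [x <= 0] the logarithm is [-oo] and the difference [+oo], so zeros of the argument are
    covered as well. *)
Lemma cst_sub_lne_ge0 (C x : R) : (x <= expR C)%R -> 0 <= C%:E - lne x%:E.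
Proof.
move=> xC; have [x0|x0] := leP x 0%R; first by rewrite le0_lneNy ?lee_fin//= leey.
by rewrite lne_EFin// -EFinB lee_fin subr_ge0 -ler_expR lnK.
Qed.

Lemma measurable_cst_sub_lne (C : R) (f : T -> R[i]) : cmeasurable f ->
  measurable_fun [set: T] (fun x => C%:E - lne (cabs (f x))%:E).
Proof.
move=> mf; have mg := measurable_cabs mf.
apply: emeasurable_funB => //.
rewrite (_ : (fun x => _) = (fun x => if (cabs (f x) <= 0)%R then -oo
  else (ln (cabs (f x)))%:E)).
  apply: measurable_fun_ifT => //; first exact: measurable_fun_ler.
  by apply/measurable_EFinP; exact: measurableT_comp.
by [].
Qed.

End cst_sub_lne.

(** The recurrence says that [I n - k] doubles with [n], so that [I (2 ^ j) - k = 2 ^ j (I 1 - k)],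
    while the bounds confine it to [[-k, k]]. *)
Lemma doubling_bounded (R : realType) (I : nat -> \bar R) (k : \bar R) :
  k \is a fin_num ->
  (forall n, (0 < n)%N -> 0 <= I n <= 2%:E * k)%E ->
  (forall n, (0 < n)%N -> I n + I n = I n.*2 + k)%E -> I 1%N = k.
Proof.
move=> kfin Ibnd Idbl.
have Ifin n : (0 < n)%N -> I n \is a fin_num.
  move=> n0; have /andP[I0 I2k] := Ibnd _ n0.
  rewrite ge0_fin_numE//; apply: le_lt_trans I2k _.
  by rewrite -(fineK kfin) -EFinM ltry.
set d := fine (I 1%N) - fine k.
have step j : fine (I (2 ^ j)%N) - fine k = 2 ^+ j * d.
  elim: j => [|j ih]; first by rewrite expn0 expr0 mul1r.
  have p0 : (0 < 2 ^ j)%N by rewrite expn_gt0.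
  have p20 : (0 < (2 ^ j).*2)%N by rewrite double_gt0.
  have := congr1 fine (Idbl _ p0).
  rewrite exprS -mulrA -ih expnS mul2n !fineD ?Ifin//; lra.
apply/eqP; rewrite -(fineK kfin) -(fineK (Ifin 1%N isT)) eqe.
rewrite -subr_eq0 -/d -normr_le0 leNgt; apply/negP => d0.
(* Chosen so that [j |d|] exceeds [k]; then [2 ^ j |d|] does too. *)
pose j := (Num.truncn (fine k / `|d|)).+1.
have kd : fine k < j%:R * `|d|.
  by rewrite -ltr_pdivrMr//; exact: truncnS_gt.
have jd : j%:R * `|d| <= 2 ^+ j * `|d|.
  by rewrite ler_wpM2r// -natrX ler_nat ltnW// ltn_expl.
have p0 : (0 < 2 ^ j)%N by rewrite expn_gt0.
have : `|2 ^+ j * d| <= fine k.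
  rewrite -step ler_norml.
  have := Ibnd _ p0.
  rewrite -(fineK (Ifin _ p0)) -(fineK kfin) -EFinM !lee_fin/=; lra.
rewrite normrM ger0_norm ?exprn_ge0//; move: kd jd; lra.
Qed.

(** * Jensen's formula for [ln |w - u|] over the disk *)

Section jensen.
Local Open Scope ereal_scope.
Context (R : realType).
Local Notation leb := (@lebesgue_measure R).
Local Notation area := (@area R).
Local Notation disk := (@unit_disk R).
Local Notation normsq := (@normsq R).
Hypothesis area_disk : area disk = pi%:E.

Section fixed_point.
Variable w : R[i].
Hypothesis w0 : w != 0%R.

Let a : R := (cabs w ^+ 2)%R.
Let a0 : (0 < a)%R. Proof. by rewrite exprn_gt0// cabs_gt0. Qed.

(** The removed circle [|u| = |w|] has area zero; off it the condition [x != y] of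
    [ln_distance_bound] holds. *)
Let D : set (plane R) := disk `&` normsq @^-1` [set~ a].

Let mD : measurable D.
Proof.
apply: measurableI; first exact: measurable_unit_disk.
by apply: measurable_normsq_preimage; exact: measurableC.
Qed.

(** The bound of [ln_distance_bound] as a function of [t = |u|^2]. *)
Let kernel (t : R) : R := (ln 2 + ln (Num.max t a) - ln `|t - a|)%R.
Let K (u : plane R) : R := kernel (normsq u).
Let L (n : nat) (u : plane R) : R := ln (cabs (w ^+ n - toC u ^+ n)%R).
(** The defect for the exponent [n], raised by its bound [K] so that only nonnegative functions are
    integrated. *)
Let H (n : nat) (u : plane R) : R :=
  (L n u - n%:R / 2 * ln (Num.max (normsq u) a) + K u)%R.

Let mln (f : plane R -> R) : measurable_fun [set: plane R] f ->
  measurable_fun [set: plane R] (fun u => ln (f u)).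
Proof. by move=> mf; exact: measurableT_comp. Qed.

Let mnormsq : measurable_fun [set: plane R] (normsq : plane R -> R).
Proof. exact: measurable_normsq. Qed.

Let mmax : measurable_fun [set: plane R] (fun u => ln (Num.max (normsq u) a)).
Proof. by apply: mln; exact: measurable_maxr. Qed.

Let mK : measurable_fun [set: plane R] K.
Proof.
apply: measurable_funB; first exact: measurable_funD.
apply: mln; apply: measurableT_comp; first exact: normr_measurable.
exact: measurable_funB.
Qed.

Let mH n : measurable_fun [set: plane R] (H n).
Proof.
apply: measurable_funD => //; apply: measurable_funB; last exact: measurable_funM.
apply: mln; apply: measurable_cabs; apply: cmeasurableB; first exact: cmeasurable_cst.
by apply: cmeasurableX; apply: cmeasurable_toC; exact: measurable_id.
Qed.

Let H_bound n u : (0 < n)%N -> D u -> (0 <= H n u <= 2 * K u)%R.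
Proof.
move=> n0 [_ ua].
have ux : cabs w != cabs (toC u).
  rewrite eq_sym; by apply/eqP => uw; apply: ua; rewrite normsqE uw.
have := @ln_distance_bound R _ _ (cabs (w ^+ n - toC u ^+ n)%R) n (cabs_ge0 _)
  (cabs_ge0 _) ux n0.
rewrite -(cabsX w n) -(cabsX (toC u) n) le_cabsB/= => /(_ _)/wrap[].
  by rewrite -[cabs (toC u ^+ n)%R]cabsN le_cabsD.
rewrite -normsqE -/a maxC (distrC a) ler_norml => /andP[].
rewrite /H /K /kernel /L; lra.
Qed.

Let K_ge0 u : D u -> (0 <= K u)%R.
Proof. by move=> /(@H_bound 1 _ isT); lra. Qed.

Let mset1 : measurable ([set a] : set (measurableTypeR R)).
Proof. exact: measurable_set1. Qed.

Let area_circle : area (disk `&` normsq @^-1` [set a]) = 0.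
Proof.
rewrite (area_normsq area_disk mset1) integral_cst/=; last first.
  by apply: measurableI => //; exact: measurable_itv.
rewrite (@subset_measure0 _ _ _ leb _ [set a]) ?mule0//.
- by apply: measurableI => //; exact: measurable_itv.
- exact: lebesgue_measure_set1.
Qed.

Let integral_disk (f : plane R -> \bar R) : measurable_fun [set: plane R] f ->
  (forall u, disk u -> 0 <= f u) ->
  \int[area]_(u in disk) f u = \int[area]_(u in D) f u.
Proof.
move=> mf f0.
rewrite (@ge0_negligible_integral _ _ _ area disk (disk `&` normsq @^-1` [set a]))//.
- by rewrite setDIr setDv set0U setDE preimage_setC.
- apply: measurableI; first exact: measurable_unit_disk.
  exact: measurable_normsq_preimage.
- exact: measurable_unit_disk.
- exact: measurable_funTS.
Qed.

(** A rotation preserves area and the modulus, hence [D]. *)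
Let integral_rotation (z : R[i]) (f : plane R -> \bar R) : cabs z = 1%R ->
  measurable_fun [set: plane R] f -> (forall u, D u -> 0 <= f u) ->
  \int[area]_(u in D) f (mulC z u) = \int[area]_(u in D) f u.
Proof.
move=> z1 mf f0; rewrite integral_mkcond [RHS]integral_mkcond.
rewrite -[RHS](area_preserving_mulC z1).2; last 2 first.
- by apply/(measurable_restrictT _ mD); exact: measurable_funTS.
- by move=> u; rewrite patchE; case: ifPn => // /[!inE]; exact: f0.
apply: eq_integral => u _; rewrite !patchE.
  have -> // : (mulC z u \in D) = (u \in D).
  by apply/idP/idP; rewrite !inE /D unit_diskE/= !normsqE toC_mulC cabsM z1 mul1r.
Qed.

Let ge0_integral_D_normsq (h : measurableTypeR R -> \bar R) :
  measurable_fun [set: measurableTypeR R] h -> (forall t, 0 <= h t) ->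
  \int[area]_(u in D) h (normsq u) = pi%:E * \int[leb]_(t in `[0%R, 1%R[) h t.
Proof.
move=> mh h0; rewrite -(ge0_integral_disk_normsq area_disk mh h0) integral_disk//.
by apply: measurableT_comp => //; exact: measurable_normsq.
Qed.

Let area_D : area D = pi%:E.
Proof.
rewrite -[LHS]mul1e -integral_cst// -integral_disk//.
by rewrite integral_cst ?mul1e//; exact: measurable_unit_disk.
Qed.

(** On the disk [K] is at most a constant plus a logarithmic pole in [|u|^2], which
    [integral_log_pole] shows to be integrable. *)
Let intK_lty : \int[area]_(u in D) (K u)%:E < +oo.
Proof.
pose pole (t : measurableTypeR R) := (Num.max 0 (- ln `|t - a|))%R.
pose c : R := (ln 2 + ln (Num.max 1 a))%R.
have c0 : (0 <= c)%R.
  by rewrite addr_ge0// ln_ge0// ?ler1n// le_max lexx.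
have pole0 t : (0 <= pole t)%R by rewrite le_max lexx.
have mpole : measurable_fun [set: measurableTypeR R] pole.
  apply: measurable_maxr => //; apply: measurableT_comp => //.
  apply: (measurableT_comp (@measurable_ln R)).
  by apply: measurableT_comp; [exact: normr_measurable|exact: measurable_funB].
have mcp : measurable_fun [set: measurableTypeR R] (fun t => (c + pole t)%:E).
  by apply/measurable_EFinP; exact: measurable_funD.
apply: (@le_lt_trans _ _ (\int[area]_(u in D) (c + pole (normsq u))%:E)).
  apply: ge0_le_integral => //.
  - by apply: measurable_funTS; exact/measurable_EFinP.
  - apply: measurable_funTS.
    by apply: (measurableT_comp mcp); exact: measurable_normsq.
  - move=> u [+ _]; rewrite unit_diskE/= in_itv/= => /andP[_ u1].
    rewrite lee_fin lerD//; last by rewrite /pole le_max lexx orbT.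
    rewrite lerD2l ler_ln ?posrE ?lt_max ?a0 ?ltr01 ?orbT//.
    by rewrite ge_max !le_max (ltW u1) lexx orbT.
rewrite (ge0_integral_D_normsq mcp) => [|t]; last by rewrite lee_fin addr_ge0.
rewrite lte_mul_pinfty ?lee_fin ?pi_ge0//.
under eq_integral do rewrite EFinD.
rewrite ge0_integralD//=; [|by move=> t _; rewrite lee_fin..
  |by apply: measurable_funTS; exact/measurable_EFinP].
rewrite integral_cst//= lebesgue_measure_itv/= lte_fin ltr01 sube0 mule1.
rewrite lte_add_pinfty ?ltry//.
apply: le_lt_trans (integral_log_pole a).
apply: ge0_subset_integral => //; first exact/measurable_EFinP.
by move=> t _; rewrite lee_fin.
Qed.

(** One copy of the left integral is rotated by [z] with [z ^ n = -1]; [w^(2n) - u^(2n)] is the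
    product of [w^n - u^n] and [w^n - (z u)^n]. The left side carries [K] twice and [H n.*2] only
    once, whence the last term. *)
Let doubling n : (0 < n)%N ->
  \int[area]_(u in D) (H n u)%:E + \int[area]_(u in D) (H n u)%:E =
  \int[area]_(u in D) (H n.*2 u)%:E + \int[area]_(u in D) (K u)%:E.
Proof.
move=> n0; have [z z1 zn] := exists_unimodular_root R n0.
have mHD k : measurable_fun [set: plane R] (fun u => (H k u)%:E).
  exact/measurable_EFinP.
have H0 k u : (0 < k)%N -> D u -> 0 <= (H k u)%:E.
  by move=> k0 Du; rewrite lee_fin; have /andP[] := H_bound k0 Du.
have Drot u : D u -> D (mulC z u).
  by rewrite /D unit_diskE/= !normsqE toC_mulC cabsM z1 mul1r.
rewrite -{1}(integral_rotation z1 (mHD n)); last by move=> u; exact: H0.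
rewrite -ge0_integralD//; last 4 first.
- by move=> u Du; apply: H0 => //; exact: Drot.
- apply: measurable_funTS; apply: (measurableT_comp (mHD n)).
  exact: (area_preserving_mulC z1).1.
- by move=> u; exact: H0.
- exact: measurable_funTS.
rewrite -ge0_integralD//; last 3 first.
- by move=> u; apply: H0; rewrite double_gt0.
- exact: measurable_funTS.
- by apply: measurable_funTS; exact/measurable_EFinP.
apply: eq_integral => u /[!inE] Du; rewrite -!EFinD; congr (_%:E).
rewrite /H /K.
have -> : normsq (mulC z u) = normsq u.
  by rewrite !normsqE toC_mulC cabsM z1 mul1r.
have uw : cabs (w ^+ n)%R != cabs (toC u ^+ n)%R.
  rewrite !cabsX eqrXn2 ?cabs_ge0//.
  apply/eqP => wu; case: Du => _; apply; rewrite /= normsqE -wu//.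
have pos (v : R[i]) : cabs v = cabs (toC u ^+ n)%R -> (0 < cabs (w ^+ n - v)%R)%R.
  move=> vu; rewrite cabs_gt0 subr_eq0; apply: contra uw => /eqP ->.
  by rewrite vu.
have -> : (L n.*2 u = L n u + L n (mulC z u))%R.
  rewrite /L -lnM ?posrE; last 2 first.
  - exact: pos.
  - by apply: pos; rewrite toC_mulC exprMn zn mulN1r cabsN.
  rewrite -cabsM toC_mulC exprMn zn -addnn !exprD; congr (ln (cabs _)); ring.
rewrite -addnn natrD.
move: (L n u) (L n _) (ln (Num.max _ _)) (kernel _) (n%:R : R)%R => x y t c r.
lra.
Qed.

(** The defect for the exponent 1 is zero: [ln |w - u|] and [ln (max |u| |w|)] have the same
    mean. *)
Let integral_H1 : \int[area]_(u in D) (H 1 u)%:E = \int[area]_(u in D) (K u)%:E.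
Proof.
apply: (@doubling_bounded _ (fun n => \int[area]_(u in D) (H n u)%:E)).
- rewrite ge0_fin_numE; first exact: intK_lty.
  by apply: integral_ge0 => u Du; rewrite lee_fin K_ge0.
- move=> n n0; apply/andP; split.
    by apply: integral_ge0 => u /(H_bound n0)/andP[]; rewrite lee_fin.
  have mK2 : measurable_fun D (fun u => (K u)%:E).
    by apply: measurable_funTS; exact/measurable_EFinP.
  rewrite -ge0_integralZl_EFin//.
  apply: ge0_le_integral => //.
  + by move=> u /(H_bound n0)/andP[]; rewrite lee_fin.
  + by apply: measurable_funTS; exact/measurable_EFinP.
  + exact: measurable_funeM.
  + by move=> u /(H_bound n0)/andP[_]; rewrite lee_fin.
- exact: doubling.
Qed.

(** Measuring [ln (max t a)] downwards from its value at [t = 1] gives a nonnegative function on the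
    disk. *)
Let E (t : R) : R := (ln (Num.max 1 a) - ln (Num.max t a))%R.

Let E_ge0 (u : plane R) : disk u -> (0 <= E (normsq u))%R.
Proof.
rewrite unit_diskE/= in_itv/= => /andP[_ u1].
rewrite subr_ge0 ler_ln ?posrE ?lt_max ?a0 ?ltr01 ?orbT//.
by rewrite ge_max !le_max (ltW u1) lexx orbT.
Qed.

Let integral_E : \int[area]_(u in D) (E (normsq u))%:E =
  (pi * (if 1 <= a then 0 else 1 - a))%:E.
Proof.
have mE : measurable_fun [set: measurableTypeR R] E.
  apply: measurable_funB => //; apply: (measurableT_comp (@measurable_ln R)).
  exact: measurable_maxr.
pose h (t : measurableTypeR R) : \bar R := (Num.max 0 (E t))%:E.
have mh : measurable_fun [set: measurableTypeR R] h.
  by apply/measurable_EFinP; exact: measurable_maxr.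
transitivity (\int[area]_(u in D) h (normsq u)).
  apply: eq_integral => u /[!inE] -[du _].
  by rewrite /h max_r//; exact: E_ge0.
rewrite (ge0_integral_D_normsq mh); last by move=> t; rewrite lee_fin le_max lexx.
rewrite EFinM -integral_Nln_max//; congr (_ * _).
apply: eq_integral => t /[!inE]; rewrite /= in_itv/= => /andP[_ t1].
rewrite /h max_r// subr_ge0 ler_ln ?posrE ?lt_max ?a0 ?ltr01 ?orbT//.
by rewrite ge_max !le_max (ltW t1) lexx orbT.
Qed.

Let L1_gt0 u : D u -> (0 < cabs (w - toC u)%R)%R.
Proof.
move=> [_ ua]; rewrite cabs_gt0 subr_eq0; apply/eqP => wu; apply: ua.
by rewrite /= normsqE -wu.
Qed.

(** The mean of [ln (max |u| |w|)] is [ln (max 1 |w|)] minus half the mean of [E]. *)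
Lemma integral_log_distance (C : R) :
  (forall u, disk u -> cabs (w - toC u)%R <= expR C)%R ->
  \int[area]_(u in disk) (C%:E - lne (cabs (w - toC u)%R)%:E) =
  (pi * (C - (if 1 <= cabs w then ln (cabs w) else (cabs w ^+ 2 - 1) / 2)))%:E.
Proof.
move=> LC.
have mwu : cmeasurable (fun u : plane R => w - toC u)%R.
  apply: cmeasurableB; first exact: cmeasurable_cst.
  by apply: cmeasurable_toC; exact: measurable_id.
rewrite integral_disk; last 2 first.
- exact: measurable_cst_sub_lne.
- by move=> u /LC; exact: cst_sub_lne_ge0.
rewrite (eq_integral (fun u => (C - L 1 u)%:E)); last first.
  by move=> u /[!inE] Du; rewrite lne_EFin ?L1_gt0// /L !expr1.
have CL0 (u : plane R) : D u -> (0 <= C - L 1 u)%R.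
  move=> Du; rewrite subr_ge0 /L !expr1 -ler_expR lnK ?posrE ?L1_gt0//.
  by apply: LC; case: Du.
pose c : R := (ln (Num.max 1 a) / 2)%R.
(* Added to both sides below to make the constant [C - c + P] nonnegative, so that every integral
   splits. *)
pose P : R := (`|C| + `|c|)%R.
have P0 : (0 <= P)%R by rewrite addr_ge0.
have CP0 : (0 <= C - c + P)%R.
  by rewrite /P; have := ler_norm c; have := ler_norm (- C); rewrite normrN; lra.
set X := \int[area]_(u in D) _.
have mD' (f : plane R -> R) : measurable_fun [set: plane R] f ->
    measurable_fun D (fun u => (f u)%:E).
  by move=> mf; apply: measurable_funTS; exact/measurable_EFinP.
have mL : measurable_fun [set: plane R] (fun u => C - L 1 u)%R.
  apply: measurable_funB => //; apply: mln; apply: measurable_cabs.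
  by rewrite /L; under eq_fun do rewrite !expr1.
have mEn : measurable_fun [set: plane R] (fun u => E (normsq u))%R.
  exact: measurable_funB.
(* [L 1] cancels between [H 1] and [C - L 1], which leaves a radial function. *)
have : \int[area]_(u in D) (H 1 u + (C - L 1 u) + P)%:E =
    \int[area]_(u in D) ((C - c + P) + E (normsq u) / 2 + K u)%:E.
  apply: eq_integral => u _; congr (_%:E); rewrite /H /E /c.
  move: (ln (Num.max 1%R a)) (ln (Num.max _ a)) (L 1 u) (K u) => x y z t; lra.
have intD (f g : plane R -> R) :
    measurable_fun [set: plane R] f -> (forall u, D u -> (0 <= f u)%R) ->
    measurable_fun [set: plane R] g -> (forall u, D u -> (0 <= g u)%R) ->
    \int[area]_(u in D) (f u + g u)%:E =
    \int[area]_(u in D) (f u)%:E + \int[area]_(u in D) (g u)%:E.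
  move=> mf f0 mg g0; under eq_integral do rewrite EFinD.
  by rewrite ge0_integralD//; exact: mD'.
have H10 (u : plane R) : D u -> (0 <= H 1 u)%R by move=> Du; have /andP[] := @H_bound 1 u isT Du.
have E2 (u : plane R) : D u -> (0 <= E (normsq u) / 2)%R.
  by move=> [du _]; rewrite divr_ge0// E_ge0.
have mE2 : measurable_fun [set: plane R] (fun u => E (normsq u) / 2)%R.
  exact: measurable_funM.
rewrite (intD (fun u => H 1 u + (C - L 1 u)) (fun=> P))%R//; last 2 first.
- exact: measurable_funD.
- by move=> u Du; rewrite addr_ge0 ?H10 ?CL0.
rewrite (intD (H 1) (fun u => C - L 1 u))%R//.
rewrite (intD (fun u => C - c + P + E (normsq u) / 2) K)%R//; last 2 first.
- exact: measurable_funD.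
- by move=> u Du; rewrite addr_ge0 ?E2.
rewrite (intD (fun=> C - c + P) (fun u => E (normsq u) / 2))%R//.
have icst (r : R) : \int[area]_(u in D) r%:E = (r * pi)%:E.
  by rewrite (integral_cst _ mD) EFinM; congr (_ * _); exact: area_D.
rewrite !icst -/X integral_H1.
have -> : \int[area]_(u in D) (E (normsq u) / 2)%:E =
    (pi * (if 1 <= a then 0 else 1 - a) / 2)%:E.
  under eq_integral do rewrite mulrC EFinM.
  rewrite ge0_integralZl_EFin//; last exact: mD'.
    by rewrite integral_E -EFinM mulrC.
  by move=> u [du _]; rewrite lee_fin E_ge0.
(* Finiteness allows this integral to be cancelled from both sides. *)
have kfin : \int[area]_(u in D) (K u)%:E \is a fin_num.
  by rewrite ge0_fin_numE ?intK_lty//; apply: integral_ge0 => u Du; rewrite lee_fin K_ge0.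
rewrite -(fineK kfin); move: (fine _) => k.
have a1 : (1 <= a)%R = (1 <= cabs w)%R by rewrite expr_ge1// cabs_ge0.
have cE : c = (if 1 <= cabs w then ln (cabs w) else 0)%R.
  rewrite /c; case: leP => [w1|/ltW w1].
    by rewrite max_r ?a1// lnXn ?cabs_gt0// mulr2n; field.
  by rewrite max_l ?ln1 ?mul0r// expr_le1// cabs_ge0.
rewrite cE a1 /a => {P0 CP0}; move: P (cabs w) (pi : R) => p v q.
case: X => [x| |]//=; case: ifPn => _ [] xE; congr (_%:E); lra.
Qed.

End fixed_point.
End jensen.

(** * Integrals of [ln |a + u b|] over the disk *)

Section jensen_affine.
Local Open Scope ereal_scope.
Context (R : realType).
Local Notation area := (@area R).
Local Notation disk := (@unit_disk R).

(** The mean of [ln |1 + c u|] over the disk as a function of [y = ln |c|]; the two branches agree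
    at [y = 0]. *)
Definition jensen_excess (y : R) : R :=
  if (0 <= y)%R then (y + (expR (- 2 * y) - 1) / 2)%R else 0%R.

Lemma jensen_excess_ge0 y : (0 <= jensen_excess y)%R.
Proof.
rewrite /jensen_excess; case: ifPn => // y0.
have := expR_ge1Dx (- 2 * y); lra.
Qed.

Lemma measurable_jensen_excess : measurable_fun [set: R] jensen_excess.
Proof.
apply: measurable_fun_ifT => //; first exact: measurable_fun_ler.
apply: measurable_funD => //; apply: measurable_funM => //.
apply: measurable_funB => //; exact: measurableT_comp.
Qed.

Lemma unit_disk_neq0 (u : plane R) : disk u ->
  (1 + toC u != 0 /\ 1 - toC u != 0)%R.
Proof.
rewrite /unit_disk /mkset => u1; split; apply/eqP => uE; move: u1.
  by rewrite (_ : toC u = - 1)%R ?cabsN ?cabs1 ?ltxx//; apply/eqP; rewrite -addr_eq0 addrC uE.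
by rewrite (_ : toC u = 1)%R ?cabs1 ?ltxx//; apply/esym/eqP; rewrite -subr_eq0 uE.
Qed.

Hypothesis area_disk : area disk = pi%:E.

(** Factoring out [b] gives [|b| |w - u|] with [w = - a / b]. Since [y = ln |b / a| = - ln |w|], the
    branch [y >= 0] corresponds to [|w| <= 1], and [e^(-2y)] is [|w|^2]. *)
Lemma integral_log_affine (a b : R[i]) (C : R) : a != 0%R -> b != 0%R ->
  (cabs a + cabs b <= expR C)%R ->
  \int[area]_(u in disk) (C%:E - lne (cabs (a + toC u * b)%R)%:E) =
  (pi * (C - ln (cabs a) - jensen_excess (ln (cabs b / cabs a))))%:E.
Proof.
move=> a0 b0 abC.
have pa : (0 < cabs a)%R by rewrite cabs_gt0.
have pb : (0 < cabs b)%R by rewrite cabs_gt0.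
pose w := (- (a / b))%R.
have w0 : (w != 0)%R by rewrite oppr_eq0 mulf_neq0// invr_eq0.
have cw : cabs w = (cabs a / cabs b)%R by rewrite cabsN cabsM cabsV.
have wE (u : plane R) : cabs (a + toC u * b)%R = (cabs b * cabs (w - toC u)%R)%R.
  by rewrite -cabsM -[RHS]cabsN; congr cabs; rewrite /w; field.
transitivity (\int[area]_(u in disk)
    ((C - ln (cabs b))%:E - lne (cabs (w - toC u)%R)%:E)).
  apply: eq_integral => u _; rewrite wE.
  (* At the zero [u = w] both logarithms are [-oo]. *)
  have [->|wu] := eqVneq (w - toC u)%R 0%R.
    by rewrite cabs0 mulr0 !le0_lneNy.
  rewrite !lne_EFin ?mulr_gt0 ?cabs_gt0// lnM ?posrE ?cabs_gt0//.
  by rewrite -!EFinB; congr (_%:E); ring.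
rewrite integral_log_distance//; last first.
  move=> u u1; rewrite expRB lnK ?posrE// ler_pdivlMr// mulrC -wE.
  apply: le_trans (le_cabsD _ _) _; apply: le_trans abC.
  by rewrite lerD2l cabsM ler_piMl// ltW.
congr (_ * _)%:E; rewrite /jensen_excess cw.
have -> : ln (cabs b / cabs a) = (- ln (cabs a / cabs b))%R.
  by rewrite !ln_div ?posrE//; ring.
rewrite oppr_ge0.
have v0 : (0 < cabs a / cabs b)%R by rewrite divr_gt0.
have lnv : (ln (cabs a / cabs b) = ln (cabs a) - ln (cabs b))%R.
  by rewrite ln_div ?posrE.
move: (cabs a / cabs b)%R v0 lnv => v v0 lnv.
have -> : expR (- 2 * - ln v) = (v ^+ 2)%R.
  by rewrite mulrNN -[in RHS](lnK v0) -expRM_natl mulr_natl.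
(* At [v = 1] the two conditionals select opposite branches, whose values agree. *)
case: (ltgtP 1%R v) => [v1|v1|v1].
- by rewrite leNgt ln_gt0//= subr0; lra.
- have lv : (ln v < 0)%R by rewrite ln_lt0// v0.
  by rewrite ltW//; lra.
- by rewrite -v1 ln1 lexx expr1n; move: lnv; rewrite -v1 ln1; lra.
Qed.

End jensen_affine.

(** * The laws of [X] and of [ln |q(X)|] *)

Section laws.
Local Open Scope ereal_scope.
Context (R : realType) (d : measure_display) (T : measurableType d).
Variables (P : probability T R) (X : {RV P >-> plane R}) (rho : R -> R).
Hypothesis X_uniform : uniform_on_disk X.
Local Notation leb := (@lebesgue_measure R).
Local Notation area := (@area R).
Local Notation disk := (@unit_disk R).

Let pi_neq0 : (pi : R) != 0%R. Proof. by rewrite gt_eqF// pi_gt0. Qed.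

(** The law of [X] has total mass 1. *)
Lemma area_unit_disk : area disk = pi%:E.
Proof.
have : distribution P X setT = 1 by exact: probability_setT.
rewrite X_uniform// setTI => /(congr1 (fun y => pi%:E * y)).
by rewrite muleA -EFinM divff// mul1e mule1.
Qed.

Lemma integral_disk_uniform (h : plane R -> \bar R) :
  measurable_fun [set: plane R] h -> (forall z, 0 <= h z) ->
  \int[area]_(z in disk) h z = pi%:E * \int[P]_w h (X w).
Proof.
move=> mh h0; have mdisk := @measurable_unit_disk R.
rewrite (@ge0_integral_law _ _ _ _ R P area setT disk X (cst pi^-1%R))//.
- under eq_integral do rewrite muleC.
  rewrite ge0_integralZl_EFin ?invr_ge0 ?pi_ge0//; last exact: measurable_funTS.
  by rewrite muleA -EFinM divff// mul1e.
- by move=> z /=; rewrite invr_ge0 pi_ge0.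
- move=> B mB; rewrite setTI/= integral_cst/=; last exact: measurableI.
  by rewrite setIC; exact: X_uniform.
Qed.

Definition log_ratio (z : plane R) : R := ln (cabs (q (toC z))).

Lemma measurable_log_ratio : measurable_fun [set: plane R] log_ratio.
Proof.
have m1 : measurable_fun [set: plane R] (fun z => cabs (1 - toC z)%R).
  apply: measurable_cabs; apply: cmeasurableB; first exact: cmeasurable_cst.
  by apply: cmeasurable_toC; exact: measurable_id.
have m2 : measurable_fun [set: plane R] (fun z => cabs (1 + toC z)%R).
  apply: measurable_cabs; apply: cmeasurableD; first exact: cmeasurable_cst.
  by apply: cmeasurable_toC; exact: measurable_id.
(* Where positive, the modulus is inverted through [expR] and [ln]; at 0 its inverse is 0, so that
   the argument of [ln] is 0. *)
rewrite (_ : log_ratio = fun z => if (cabs (1 + toC z)%R <= 0)%R then ln 0%R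
  else ln (cabs (1 - toC z)%R * expR (- ln (cabs (1 + toC z)%R)))).
  apply: measurable_fun_ifT => //; first exact: measurable_fun_ler.
  apply: (measurableT_comp (@measurable_ln R)); apply: measurable_funM => //.
  by apply: measurableT_comp => //; apply: measurableT_comp => //; exact: measurableT_comp.
apply/funext => z; rewrite /log_ratio /q cabsM cabsV.
case: leP => z0; last by rewrite expRN lnK.
have -> : cabs (1 + toC z)%R = 0%R by apply/eqP; rewrite eq_le z0 cabs_ge0.
by rewrite invr0 mulr0.
Qed.

(** Passing to the coefficients [a (1 + z)] and [b (1 - z)] translates [ln |b / a|]; iterating these
    translations is what produces convolution powers. *)
Lemma log_ratioE z (a b : R[i]) : a != 0%R -> b != 0%R -> disk z ->
  (ln (cabs (b * (1 - toC z)) / cabs (a * (1 + toC z))) =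
   ln (cabs b / cabs a) + log_ratio z)%R.
Proof.
move=> a0 b0 /unit_disk_neq0[zp zm].
rewrite /log_ratio /q !cabsM cabsV -lnM ?posrE ?divr_gt0 ?cabs_gt0//.
by congr ln; rewrite mulf_div.
Qed.

Hypothesis rho_density : is_density P (fun w => ln (cabs (q (toC (X w))))) rho.

(** Two transports: from the disk to the probability space along [X], then to the line with density
    [rho]. *)
Lemma integral_disk_log_ratio (h : measurableTypeR R -> \bar R) :
  measurable_fun [set: measurableTypeR R] h -> (forall y, 0 <= h y) ->
  \int[area]_(z in disk) h (log_ratio z) =
  pi%:E * \int[leb]_y (h y * (rho y)%:E).
Proof.
move=> mh h0; case: rho_density => mrho rho0 PY.
rewrite (@integral_disk_uniform (fun z => h (log_ratio z)))//; last first.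
  by apply: measurableT_comp => //; exact: measurable_log_ratio.
congr (_ * _).
rewrite (@ge0_integral_law _ _ _ _ R P leb setT setT
  (fun w => log_ratio (X w)) rho)//.
- apply: (measurableT_comp measurable_log_ratio); exact: measurable_funP.
- by move=> B mB; rewrite !setTI; exact: PY.
Qed.

Lemma integral_density : \int[leb]_y (rho y)%:E = 1.
Proof.
case: rho_density => mrho rho0 PY.
by rewrite -PY// preimage_setT probability_setT.
Qed.

End laws.

(** * Integration against a convolution *)

Section convolution.
Local Open Scope ereal_scope.
Context (R : realType).
Local Notation leb := (@lebesgue_measure R).
Variables f g : R -> R.
Hypotheses (mf : measurable_fun [set: R] f) (mg : measurable_fun [set: R] g).
Hypotheses (f0 : forall x, (0 <= f x)%R) (g0 : forall x, (0 <= g x)%R).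
Hypotheses (intf : \int[leb]_x (f x)%:E = 1) (intg : \int[leb]_x (g x)%:E = 1).

(** The convolution with extended real values, to which Tonelli applies; [convolution f g] differs
    from it only where it is infinite. *)
Let E (y : measurableTypeR R) : \bar R := \int[leb]_t (f t * g (y - t))%:E.

Let conv_integrand (p : measurableTypeR R * measurableTypeR R) : \bar R :=
  (f p.2 * g (p.1 - p.2))%:E.

Let m_conv_integrand :
  measurable_fun [set: measurableTypeR R * measurableTypeR R] conv_integrand.
Proof.
apply/measurable_EFinP; apply: measurable_funM; apply: measurableT_comp => //.
exact: measurable_funB.
Qed.

Let E_ge0 y : 0 <= E y.
Proof. by apply: integral_ge0 => t _; rewrite lee_fin mulr_ge0. Qed.

Let mE : measurable_fun [set: measurableTypeR R] E.
Proof.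
apply: (@measurable_fun_fubini_tonelli_F _ _ _ _ R leb conv_integrand) => //.
by move=> p; rewrite lee_fin mulr_ge0.
Qed.

Lemma convolution_ge0 y : (0 <= convolution f g y)%R.
Proof. exact: fine_ge0 (E_ge0 y). Qed.

Lemma measurable_convolution : measurable_fun [set: R] (convolution f g).
Proof. by apply: measurableT_comp => //; exact: mE. Qed.

(** Tonelli for [h y * f t * g (y - t)], with the translation [y = t + s]. *)
Let integral_E (h : measurableTypeR R -> \bar R) :
  measurable_fun [set: measurableTypeR R] h -> (forall y, 0 <= h y) ->
  \int[leb]_t (\int[leb]_s (h (t + s)%R * (g s)%:E) * (f t)%:E) =
  \int[leb]_y (h y * E y).
Proof.
move=> mh h0.
pose k (p : measurableTypeR R * measurableTypeR R) : \bar R :=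
  h p.1 * conv_integrand p.
have k0 p : 0 <= k p by rewrite mule_ge0// lee_fin mulr_ge0.
have mk : measurable_fun [set: measurableTypeR R * measurableTypeR R] k.
  by apply: emeasurable_funM => //; exact: measurableT_comp.
transitivity (\int[leb]_t \int[leb]_y k (y, t)).
  apply: eq_integral => t _; rewrite muleC.
  rewrite -ge0_integralZl_EFin//; last 2 first.
  - by move=> s _; rewrite mule_ge0// lee_fin.
  - apply: emeasurable_funM.
      by apply: (measurableT_comp mh); exact: measurable_funD.
    exact/measurable_EFinP.
  rewrite -(@ge0_integral_shift _ t (fun y => k (y, t)))//; last first.
    by apply: (measurableT_comp mk); exact: measurable_fun_pair.
  apply: eq_integral => s _; rewrite /k /conv_integrand/=.
  by rewrite addrK muleCA -EFinM addrC.
rewrite -(@fubini_tonelli _ _ _ _ R leb leb k)//.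
apply: eq_integral => y _; rewrite /k/= ge0_integralZl//.
- by apply: (measurableT_comp m_conv_integrand); exact: measurable_fun_pair.
- by move=> t _; rewrite lee_fin mulr_ge0.
Qed.

(** By [integral_E] at [h = 1], [E] has integral 1. *)
Let E_fin : {ae leb, forall y, E y \is a fin_num}.
Proof.
have int_E : \int[leb]_y E y = 1.
  have := @integral_E (cst 1).
  under [in X in _ -> _ -> _ = X]eq_integral do rewrite mul1e.
  move=> <-//.
  rewrite -[RHS]intf; apply: eq_integral => t _.
  under eq_integral do rewrite mul1e.
  by rewrite intg mul1e.
have iE : leb.-integrable setT E.
  apply/integrableP; split => //.
  under eq_integral do rewrite gee0_abs//.
  by rewrite int_E ltry.
have := integrable_ae measurableT iE.
by apply: filterS => y /(_ I).
Qed.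

Lemma integral_convolution (h : measurableTypeR R -> \bar R) :
  measurable_fun [set: measurableTypeR R] h -> (forall y, 0 <= h y) ->
  \int[leb]_y (h y * (convolution f g y)%:E) =
  \int[leb]_t (\int[leb]_s (h (t + s)%R * (g s)%:E) * (f t)%:E).
Proof.
move=> mh h0; rewrite integral_E//; apply: ae_eq_integral => //.
- apply: emeasurable_funM => //; apply/measurable_EFinP.
  exact: measurable_convolution.
- exact: emeasurable_funM.
- apply: filterS E_fin => y Ey _; congr (_ * _).
  by rewrite /convolution /Rintegral fineK.
Qed.

Lemma integral_convolution1 : \int[leb]_y (convolution f g y)%:E = 1.
Proof.
have := @integral_convolution (cst 1).
under [in X in _ -> _ -> X = _]eq_integral do rewrite mul1e.
move=> ->//; rewrite -[RHS]intf; apply: eq_integral => t _.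
under eq_integral do rewrite mul1e.
by rewrite intg mul1e.
Qed.

End convolution.

(** * Tonelli's theorem on tuples *)

Section tuple_integral.
Local Open Scope ereal_scope.
Context d (T : measurableType d) (R : realType).
Variable mu : {sigma_finite_measure set T -> \bar R}.

(** The measure on longer tuples is the image of a product under [cons_pair], so this is Tonelli on
    that product. *)
Lemma ge0_integral_tuple_cons n (f : n.+1.-tuple T -> \bar R) :
  measurable_fun [set: n.+1.-tuple T] f -> (forall t, 0 <= f t) ->
  \int[tuple_measure mu n.+1]_t f t =
  \int[mu]_x \int[tuple_measure mu n]_t f [tuple of x :: t].
Proof.
move=> mf f0.
have mcons := @measurable_cons_pair d T n.
rewrite -(@fubini_tonelli1 _ _ _ _ R mu (tuple_measure mu n) (f \o @cons_pair _ _ n))//.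
- apply/esym.
  rewrite (@ge0_integral_law _ _ _ _ R (mu \x tuple_measure mu n)
    (tuple_measure mu n.+1) setT setT (@cons_pair _ _ n) (cst 1%R))//.
  + by apply: eq_integral => t _; rewrite mule1.
  + by move=> B mB; rewrite !setTI/= integral_cst//= mul1e.
- exact: measurableT_comp.
- by move=> p; exact: f0.
Qed.

Lemma integral_tuple0 (f : 0.-tuple T -> \bar R) :
  measurable_fun [set: 0.-tuple T] f ->
  \int[tuple_measure mu 0]_t f t = f [tuple].
Proof. by move=> mf; rewrite integral_dirac// diracT mul1e. Qed.

End tuple_integral.

(** * Integration over the polydisk, one variable at a time *)

Section polydisk.
Local Open Scope ereal_scope.
Context (R : realType).
Local Notation area := (@area R).
Local Notation disk := (@unit_disk R).

Lemma polydisk_cons n (x : plane R) (t : n.-tuple (plane R)) :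
  polydisk [tuple of x :: t] <-> disk x /\ polydisk t.
Proof.
split=> [xt|[dx dt] i].
  split; first exact: (xt ord0).
  by move=> i; have := xt (lift ord0 i); rewrite tnthS.
by case: (unliftP ord0 i) => [j ->|->]; rewrite ?tnthS ?tnth0.
Qed.

Lemma measurable_polydisk n : measurable (@polydisk R n).
Proof.
rewrite (_ : @polydisk R n =
    \bigcap_(i in [set: 'I_n]) ((fun z => tnth z i) @^-1` disk)).
  apply: fin_bigcap_measurable => [|i _]; first exact: finite_finset.
  rewrite -[X in measurable X]setTI; apply: measurable_tnth => //.
  exact: measurable_unit_disk.
by apply/seteqP; split => z zP i //; [move=> _; exact: zP|exact: zP].
Qed.

Section polydisk_cons_integral.
Variables (n : nat) (f : n.+1.-tuple (plane R) -> \bar R).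
Hypothesis mf : measurable_fun [set: n.+1.-tuple (plane R)] f.
Hypothesis f0 : forall t, polydisk t -> 0 <= f t.

(** Extension by zero moves the integral to the whole space, where Tonelli is available. *)
Let g := f \_ (@polydisk R n.+1).

Let g0 t : 0 <= g t.
Proof. by rewrite /g patchE; case: ifPn => // /[!inE]; exact: f0. Qed.

Let mg : measurable_fun [set: n.+1.-tuple (plane R)] g.
Proof.
apply/(measurable_restrictT _ (@measurable_polydisk n.+1)).
exact: measurable_funTS.
Qed.

Let integral_g x : disk x ->
  \int[tuple_measure area n]_t g [tuple of x :: t] =
  \int[tuple_measure area n]_(t in @polydisk R n) f [tuple of x :: t].
Proof.
move=> dx; rewrite [RHS]integral_mkcond; apply: eq_integral => t _.
rewrite /g !patchE; have [xt tx] := polydisk_cons x t.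
have -> // : ([tuple of x :: t] \in @polydisk R n.+1) = (t \in @polydisk R n).
by apply/idP/idP; rewrite !inE; [case/xt|move=> dt; exact: tx].
Qed.

Lemma ge0_integral_polydisk_cons :
  \int[tuple_measure area n.+1]_(z in @polydisk R n.+1) f z =
  \int[area]_(x in disk)
    \int[tuple_measure area n]_(t in @polydisk R n) f [tuple of x :: t].
Proof.
rewrite integral_mkcond ge0_integral_tuple_cons//.
rewrite [RHS]integral_mkcond; apply: eq_integral => x _.
rewrite patchE; case: ifPn => [/[!inE] dx|/negP ndx]; first exact: integral_g.
apply: integral0_eq => t _; rewrite patchE memNset// => xt.
by apply: ndx; rewrite inE; have [] := (polydisk_cons x t).1 xt.
Qed.

Lemma measurable_integral_polydisk_cons : measurable_fun disk (fun x =>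
  \int[tuple_measure area n]_(t in @polydisk R n) f [tuple of x :: t]).
Proof.
apply: (eq_measurable_fun (fun x => \int[tuple_measure area n]_t g [tuple of x :: t])).
  by move=> x /[!inE]; exact: integral_g.
apply: measurable_funTS.
apply: (@measurable_fun_fubini_tonelli_F _ _ _ _ R (tuple_measure area n)
  (g \o @cons_pair _ (plane R) n)) => [|p]; last exact: g0.
by apply: measurableT_comp => //; exact: measurable_cons_pair.
Qed.

End polydisk_cons_integral.

Lemma integral_polydisk0 (f : 0.-tuple (plane R) -> \bar R) :
  measurable_fun [set: 0.-tuple (plane R)] f ->
  \int[tuple_measure area 0]_(z in @polydisk R 0) f z = f [tuple].
Proof.
move=> mf; rewrite (_ : @polydisk R 0 = setT) ?integral_tuple0//.
by apply/seteqP; split => // z _ [].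
Qed.

Hypothesis area_disk : area disk = pi%:E.

Lemma tuple_measure_polydisk n :
  tuple_measure area n (@polydisk R n) = (pi ^+ n)%:E.
Proof.
elim: n => [|n ih].
  rewrite -[LHS]mul1e -integral_cst; last exact: measurable_polydisk.
  by rewrite integral_polydisk0//= expr0.
rewrite -[LHS]mul1e -integral_cst; last exact: measurable_polydisk.
rewrite ge0_integral_polydisk_cons//.
transitivity (\int[area]_(x in disk) (pi ^+ n)%:E).
  apply: eq_integral => x _.
  by rewrite (integral_cst _ (@measurable_polydisk n)) mul1e.
rewrite (integral_cst _ (@measurable_unit_disk R)) exprSr EFinM.
by congr (_ * _).
Qed.

End polydisk.

(** * The polynomial [Pm] with general coefficients *)

Section twisted_product.
Context (R : realType).
Local Notation disk := (@unit_disk R).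
Implicit Types a b : R[i].

(* Integrating out the first variable of [Pm] multiplies the coefficients
   a and b by 1 + x and 1 - x. *)
Definition twisted_product m a b (z : m.+1.-tuple (plane R)) : R[i] :=
  a * \prod_(j < m) (1 + toC (tnth z (widen_ord (leqnSn m) j))) +
  toC (tnth z ord_max) *
    (b * \prod_(j < m) (1 - toC (tnth z (widen_ord (leqnSn m) j)))).

Lemma twisted_product0 a b x (t : 0.-tuple (plane R)) :
  twisted_product a b [tuple of x :: t] = a + toC x * b.
Proof.
rewrite /twisted_product !big_ord0 !mulr1.
by rewrite (_ : ord_max = ord0) ?tnth0//; exact/val_inj.
Qed.

Lemma twisted_product_cons m a b x (t : m.+1.-tuple (plane R)) :
  twisted_product a b [tuple of x :: t] =
  twisted_product (a * (1 + toC x)) (b * (1 - toC x)) t.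
Proof.
rewrite /twisted_product !big_ord_recl !mulrA.
have -> : widen_ord (leqnSn m.+1) ord0 = ord0 by exact/val_inj.
have -> : ord_max = lift ord0 ord_max :> 'I_m.+2 by exact/val_inj.
rewrite tnth0 tnthS.
have widenS (j : 'I_m) : widen_ord (leqnSn m.+1) (lift ord0 j) =
    lift ord0 (widen_ord (leqnSn m) j) by exact/val_inj.
by congr (_ * _ + _ * _); apply: eq_bigr => j _; rewrite widenS tnthS.
Qed.

Lemma cmeasurable_twisted_product m a b : cmeasurable (@twisted_product m a b).
Proof.
have mt (j : 'I_m.+1) : cmeasurable (fun z : m.+1.-tuple (plane R) => toC (tnth z j)).
  by apply: cmeasurable_toC; exact: measurable_tnth.
apply: cmeasurableD; apply: cmeasurableM.
- exact: cmeasurable_cst.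
- apply: cmeasurable_prod => j; apply: cmeasurableD => //; exact: cmeasurable_cst.
- exact: mt.
- apply: cmeasurableM; first exact: cmeasurable_cst.
  by apply: cmeasurable_prod => j; apply: cmeasurableB => //; exact: cmeasurable_cst.
Qed.

Lemma le_cabs_twist a b (x : plane R) : disk x ->
  cabs (a * (1 + toC x)) + cabs (b * (1 - toC x)) <= (cabs a + cabs b) * 2.
Proof.
rewrite /unit_disk/mkset => x1; rewrite mulrDl !cabsM.
have h (z : R[i]) : cabs z < 1 -> cabs (1 + z) <= 2.
  by move=> z1; apply: le_trans (le_cabsD _ _) _; rewrite cabs1; lra.
by apply: lerD; apply: ler_wpM2l; rewrite ?cabs_ge0//; apply: h; rewrite ?cabsN.
Qed.

(** Each of the first [m] variables at most doubles [|a| + |b|]; the last one has modulus below 1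
    and adds no factor. *)
Lemma twisted_product_le m a b C (z : m.+1.-tuple (plane R)) :
  (cabs a + cabs b) * 2 ^+ m <= C -> polydisk z ->
  cabs (twisted_product a b z) <= C.
Proof.
elim: m a b z => [|m ih] a b z; case/tupleP: z => x t abC /polydisk_cons[dx dt].
  rewrite twisted_product0; apply: le_trans (le_cabsD _ _) _.
  move: abC; rewrite expr0 mulr1; apply: le_trans; rewrite lerD2l cabsM.
  by rewrite ler_piMl ?cabs_ge0// ltW.
rewrite twisted_product_cons; apply: ih => //; apply: le_trans abC.
rewrite exprS mulrA ler_wpM2r ?exprn_ge0//; exact: le_cabs_twist.
Qed.

Lemma meval_Pm m (z : m.+1.-tuple (plane R)) :
  mpoly.meval (fun i => toC (tnth z i)) (Pm R m) = twisted_product 1 1 z.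
Proof.
rewrite /Pm /twisted_product !mul1r.
rewrite mpoly.mevalD mpoly.mevalM !rmorph_prod /Pm_u mpoly.mevalXU.
congr (_ + _ * _); apply: eq_bigr => j _.
  by rewrite rmorphD rmorph1 /= /Pm_x mpoly.mevalXU.
by rewrite rmorphB rmorph1 /= /Pm_x mpoly.mevalXU.
Qed.

End twisted_product.

(** * Iterated averages against [rho] *)

Section iterated_excess.
Local Open Scope ereal_scope.
Context (R : realType).
Local Notation leb := (@lebesgue_measure R).
Variable rho : R -> R.
Hypotheses (mrho : measurable_fun [set: R] rho) (rho0 : forall y, (0 <= rho y)%R).

(** For a probability density [rho], the expectation of [jensen_excess] at [c] plus the sum of [m]
    independent variables of density [rho]. *)
Fixpoint iterated_excess (m : nat) (c : measurableTypeR R) : \bar R :=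
  if m is k.+1 then \int[leb]_t (iterated_excess k (c + t)%R * (rho t)%:E)
  else (jensen_excess c)%:E.

Lemma iterated_excess_ge0 m c : 0 <= iterated_excess m c.
Proof.
elim: m c => [|m ih] c; first by rewrite lee_fin jensen_excess_ge0.
by apply: integral_ge0 => t _; rewrite mule_ge0// lee_fin.
Qed.

Lemma measurable_iterated_excess m :
  measurable_fun [set: measurableTypeR R] (iterated_excess m).
Proof.
elim: m => [|m ih].
  by apply/measurable_EFinP; exact: measurable_jensen_excess.
pose k (p : measurableTypeR R * measurableTypeR R) : \bar R :=
  iterated_excess m (p.1 + p.2)%R * (rho p.2)%:E.
apply: (@measurable_fun_fubini_tonelli_F _ _ _ _ R leb k).
  apply: emeasurable_funM.
    by apply: (measurableT_comp ih); exact: measurable_funD.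
  by apply/measurable_EFinP; exact: measurableT_comp.
by move=> p; rewrite mule_ge0 ?iterated_excess_ge0// lee_fin.
Qed.

Hypothesis rho1 : \int[leb]_y (rho y)%:E = 1.

Lemma convolution_pow_density m :
  [/\ measurable_fun [set: R] (convolution_pow rho m.+1),
      forall y, (0 <= convolution_pow rho m.+1 y)%R &
      \int[leb]_y (convolution_pow rho m.+1 y)%:E = 1].
Proof.
elim: m => [|m [mr r0 r1]]; first by split.
split; first exact: measurable_convolution.
  exact: convolution_ge0.
exact: integral_convolution1.
Qed.

(** In [convolution_pow] the newest factor [rho] is the left one, which [integral_convolution]
    integrates outermost, as the recursion does. *)
Lemma iterated_excessE m c : iterated_excess m.+1 c =
  \int[leb]_y ((jensen_excess (c + y))%:E * (convolution_pow rho m.+1 y)%:E).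
Proof.
elim: m c => [//|m ih] c; have [mr r0 r1] := convolution_pow_density m.
pose h (y : measurableTypeR R) : \bar R := (jensen_excess (c + y))%:E.
have -> : convolution_pow rho m.+2 = convolution rho (convolution_pow rho m.+1).
  by [].
rewrite (@integral_convolution _ rho _ mrho mr rho0 r0 rho1 r1 h)//; last 2 first.
- apply/measurable_EFinP; apply: (measurableT_comp (@measurable_jensen_excess R)).
  exact: measurable_funD.
- by move=> y; rewrite lee_fin jensen_excess_ge0.
rewrite [LHS]/=; apply: eq_integral => t _; rewrite -/(iterated_excess m.+1 _) ih.
by congr (_ * _); apply: eq_integral => s _; rewrite /h addrA.
Qed.

End iterated_excess.

(** * Jensen's formula on the polydisk *)

Section jensen_polydisk.
Local Open Scope ereal_scope.
Context (R : realType) (d : measure_display) (T : measurableType d).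
Variables (P : probability T R) (X : {RV P >-> plane R}) (rho : R -> R).
Hypothesis X_uniform : uniform_on_disk X.
Hypothesis rho_density : is_density P (fun w => ln (cabs (q (toC (X w))))) rho.
Local Notation leb := (@lebesgue_measure R).
Local Notation area := (@area R).
Local Notation disk := (@unit_disk R).

Let area_disk : area disk = pi%:E := area_unit_disk X_uniform.

(** Stated as a sum because the iterated average is not yet known to be finite. The induction keeps
    [a] and [b] arbitrary, since integrating out a variable changes them. *)
Lemma integral_polydisk_twisted_product m (a b : R[i]) (C : R) :
  ((cabs a + cabs b) * 2 ^+ m <= expR C)%R -> a != 0%R -> b != 0%R ->
  \int[tuple_measure area m.+1]_(z in @polydisk R m.+1)
    (C%:E - lne (cabs (twisted_product a b z))%:E) +
  (pi ^+ m.+1)%:E * iterated_excess rho m (ln (cabs b / cabs a)) =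
  (pi ^+ m.+1 * (C - ln (cabs a)))%:E.
Proof.
have [mrho rho0 _] := rho_density.
have mdisk := @measurable_unit_disk R.
have mF k a' b' C' : measurable_fun [set: k.+1.-tuple (plane R)]
    (fun z => C'%:E - lne (cabs (twisted_product a' b' z))%:E).
  by apply: measurable_cst_sub_lne; exact: cmeasurable_twisted_product.
have mcons k (x : plane R) : measurable_fun [set: k.-tuple (plane R)]
    (fun t => [tuple of x :: t]).
  have mx : measurable_fun [set: k.-tuple (plane R)] (fun t => (x, t)).
    exact: measurable_fun_pair.
  exact: (measurableT_comp (@measurable_cons_pair _ (plane R) k) mx).
elim: m a b => [|m ih] a b abC a0 b0.
  rewrite ge0_integral_polydisk_cons//; last first.
    by move=> z /(twisted_product_le abC); exact: cst_sub_lne_ge0.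
  transitivity (\int[area]_(x in disk) (C%:E - lne (cabs (a + toC x * b)%R)%:E) +
     (pi ^+ 1)%:E * iterated_excess rho 0 (ln (cabs b / cabs a))).
    congr (_ + _); apply: eq_integral => x _.
    rewrite integral_polydisk0 ?twisted_product0//.
    exact: measurableT_comp (mF _ _ _ _) (mcons _ _).
  rewrite integral_log_affine//; last by move: abC; rewrite expr0 mulr1.
  by rewrite /= -EFinM -EFinD expr1; congr (_%:E); ring.
rewrite ge0_integral_polydisk_cons//; last first.
  by move=> z /(twisted_product_le abC); exact: cst_sub_lne_ge0.
pose c := ln (cabs b / cabs a).
(* The outer average against [rho] becomes an integral over the first variable again, so that both
   terms fit under one integral. *)
have -> : (pi ^+ m.+2)%:E * iterated_excess rho m.+1 c =
    \int[area]_(x in disk)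
      ((pi ^+ m.+1)%:E * iterated_excess rho m (c + log_ratio x)%R).
  have mg := measurable_iterated_excess mrho rho0 m.
  have mgc : measurable_fun [set: measurableTypeR R]
      (fun y => iterated_excess rho m (c + y)%R).
    by apply: (measurableT_comp mg); exact: measurable_funD.
  rewrite ge0_integralZl_EFin//; last 3 first.
  - by move=> x _; exact: iterated_excess_ge0.
  - apply: measurable_funTS; apply: (measurableT_comp mgc).
    exact: measurable_log_ratio.
  - by rewrite exprn_ge0// pi_ge0.
  rewrite (integral_disk_log_ratio X_uniform rho_density mgc) => [|y].
    by rewrite exprSr EFinM muleA.
  exact: iterated_excess_ge0.
have step x : disk x ->
    \int[tuple_measure area m.+1]_(t in @polydisk R m.+1)
      (C%:E - lne (cabs (twisted_product a b [tuple of x :: t]))%:E) +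
    (pi ^+ m.+1)%:E * iterated_excess rho m (c + log_ratio x)%R =
    (pi ^+ m.+1 * (C - ln (cabs a) - ln (cabs (1 + toC x)%R)))%:E.
  move=> dx; have [xp xm] := unit_disk_neq0 dx.
  rewrite -(log_ratioE a0 b0 dx).
  under eq_integral do rewrite twisted_product_cons.
  rewrite ih ?mulf_neq0//.
    by rewrite cabsM lnM ?posrE ?cabs_gt0//; congr (_%:E); ring.
  apply: le_trans abC; rewrite exprS mulrA ler_wpM2r ?exprn_ge0//.
  exact: le_cabs_twist.
rewrite -ge0_integralD//; last 4 first.
- move=> x dx; apply: integral_ge0 => t dt; apply: cst_sub_lne_ge0.
  by apply: (twisted_product_le abC); exact: (polydisk_cons x t).2.
- apply: (@measurable_integral_polydisk_cons R m.+1 (fun z =>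
    C%:E - lne (cabs (twisted_product a b z))%:E)) => [|z]; first exact: mF.
  by move=> /(twisted_product_le abC); exact: cst_sub_lne_ge0.
- move=> x _; rewrite mule_ge0 ?iterated_excess_ge0//.
  by rewrite lee_fin exprn_ge0// pi_ge0.
- apply: measurable_funeM; apply: measurable_funTS.
  apply: (measurableT_comp (measurable_iterated_excess mrho rho0 m)).
  by apply: measurable_funD => //; exact: measurable_log_ratio.
have pa : (0 < cabs a)%R by rewrite cabs_gt0.
(* The bound needed to apply [integral_log_affine] with both coefficients 1; it comes from
   [2 |a| <= |a| 2^(m+1) <= expR C]. *)
have a2C : (cabs (1 : R[i]) + cabs (1 : R[i]) <= expR (C - ln (cabs a)))%R.
  rewrite cabs1 expRB lnK// ler_pdivlMr//; apply: le_trans abC.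
  apply: (@le_trans _ _ (cabs a * 2 ^+ m.+1)%R); last first.
    by rewrite ler_wpM2r ?exprn_ge0// lerDl cabs_ge0.
  rewrite mulrC ler_wpM2l ?cabs_ge0// exprS ler_peMr// exprn_ege1//; lra.
(* What remains is [C - ln |a| - ln |1 + x|], and [ln |1 + x|] has mean [jensen_excess 0 = 0]. *)
transitivity (\int[area]_(x in disk) ((pi ^+ m.+1)%:E *
    ((C - ln (cabs a))%:E - lne (cabs (1 + toC x * 1)%R)%:E))).
  apply: eq_integral => x /[!inE] dx; rewrite step// mulr1.
  have [xp _] := unit_disk_neq0 dx.
  by rewrite lne_EFin ?cabs_gt0// -EFinB -EFinM; congr (_%:E); ring.
rewrite ge0_integralZl_EFin//; last 3 first.
- move=> x dx; apply: cst_sub_lne_ge0; apply: le_trans a2C.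
  apply: le_trans (le_cabsD _ _) _; rewrite lerD2l mulr1 cabs1; exact: ltW.
- apply: measurable_funTS; apply: measurable_cst_sub_lne.
  apply: cmeasurableD; first exact: cmeasurable_cst.
  apply: cmeasurableM; last exact: cmeasurable_cst.
  by apply: cmeasurable_toC; exact: measurable_id.
- by rewrite exprn_ge0// pi_ge0.
rewrite (integral_log_affine area_disk _ _ a2C) ?oner_eq0// cabs1 divr1 ln1.
rewrite /jensen_excess lexx mulr0 expR0 subrr mul0r addr0 !subr0.
by rewrite -EFinM mulrA -exprSr.
Qed.

End jensen_polydisk.

(** * From the integral of [C - ln |.|] back to the areal Mahler measure *)

Theorem theorem3p2 (R : realType) (d : measure_display) (T : measurableType d)
    (P : probability T R) (X : {RV P >-> plane R}) (rho : R -> R)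
    (X_uniform : uniform_on_disk X)
    (rho_density : is_density P (fun w => ln (cabs (q (toC (X w))))) rho)
    (m : nat) (m_ge1 : (1 <= m)%N) :
  areal_mahler (Pm R m) =
  (\int[lebesgue_measure]_(y in `[0%R, +oo[)
     ((y + (expR (- 2 * y) - 1) / 2) * convolution_pow rho m y)%:E)%E.
Proof.
case: m m_ge1 => // m _.
have area_disk := area_unit_disk X_uniform.
have [mrho rho0 _] := rho_density.
have rho1 := integral_density rho_density.
have [mr r0 _] := convolution_pow_density mrho rho0 rho1 m.
(* After the case analysis there are [m.+1] variables [x_j], hence [m.+2] in all; [2 ^ n] is the
   bound of [twisted_product_le] at [a = b = 1]. *)
pose n := m.+2; pose V : R := pi ^+ n; pose C : R := ln (2 ^+ n).
have V0 : 0 < V by rewrite exprn_gt0// pi_gt0.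
pose F (z : n.-tuple (plane R)) := (C%:E - lne (cabs (twisted_product 1 1 z))%:E)%E.
have FC : (cabs (1 : R[i]) + cabs (1 : R[i])) * 2 ^+ m.+1 <= expR C.
  by rewrite cabs1 lnK ?posrE ?exprn_gt0// exprS.
have mF : measurable_fun [set: n.-tuple (plane R)] F.
  by apply: measurable_cst_sub_lne; exact: cmeasurable_twisted_product.
have F0 z : polydisk z -> (0 <= F z)%E.
  by move=> /(twisted_product_le FC); exact: cst_sub_lne_ge0.
pose I := (\int[tuple_measure (@area R) n]_(z in @polydisk R n) F z)%E.
pose J := (\int[lebesgue_measure]_(y in `[0%R, +oo[)
     ((y + (expR (- 2 * y) - 1) / 2) * convolution_pow rho m.+1 y)%:E)%E.
have I0 : (0 <= I)%E by exact: integral_ge0.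
(* For [a = b = 1] the starting point [ln |b / a|] is 0, and [jensen_excess] vanishes on the
   negative half-line. *)
have JE : iterated_excess rho m.+1 0 = J.
  rewrite iterated_excessE// /J [RHS]integral_mkcond; apply: eq_integral => y _.
  rewrite add0r -EFinM patchE mem_setE in_itv/= andbT /jensen_excess.
  by case: ifPn => //; rewrite mul0r.
have J0 : (0 <= J)%E by rewrite -JE; exact: iterated_excess_ge0.
have IJ : (I + V%:E * J = (V * C)%:E)%E.
  rewrite -JE.
  have := integral_polydisk_twisted_product X_uniform rho_density
    FC (oner_neq0 _) (oner_neq0 _).
  by rewrite cabs1 divr1 ln1 subr0.
(* As [J] is nonnegative, [IJ] bounds [I] by [V * C]. *)
have Ioo : (I < +oo)%E.
  rewrite (@le_lt_trans _ _ (V * C)%:E) ?ltry// -IJ leeDl// mule_ge0//.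
  by rewrite lee_fin ltW.
have mpoly := @measurable_polydisk R n.
have vol : tuple_measure (@area R) n (@polydisk R n) = V%:E.
  exact: tuple_measure_polydisk.
have intc (r : R) : (\int[tuple_measure (@area R) n]_(z in @polydisk R n) r%:E =
    (r * V)%:E)%E.
  by rewrite (integral_cst _ mpoly) EFinM; congr (_ * _)%E; exact: vol.
rewrite -/J /areal_mahler -/n.
under eq_integral do rewrite meval_Pm.
have -> : (\int[tuple_measure (@area R) n]_(z in @polydisk R n)
    lne (cabs (twisted_product 1 1 z))%:E = (C * V)%:E - I)%E.
  rewrite -intc -integralB//.
  - apply: eq_integral => z _; rewrite /F.
    by case: (lne _) => [x| |]//=; rewrite -!EFinB; congr (_%:E); ring.
  - apply/integrableP; split=> //.
    by rewrite intc ltry.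
  - apply/integrableP; split; first exact: measurable_funTS.
    rewrite (eq_integral F) => [//|z /[!inE] pz]; rewrite gee0_abs//; exact: F0.
have Ifin : I \is a fin_num by rewrite ge0_fin_numE.
move: IJ; rewrite -(fineK Ifin); move: (fine I) => i.
have VV : V^-1 * V = 1 by rewrite mulVf ?gt_eqF.
have -> : pi ^- n = V^-1 :> R by [].
(* [J = +oo] would contradict [IJ], whose right-hand side is finite. *)
case: J J0 {JE} => [j _|_|//].
  move=> -[ij]; rewrite -EFinB -EFinM; congr (_%:E).
  have -> : C * V - i = V * j by rewrite mulrC -ij; ring.
  by rewrite mulrA VV mul1r.
by rewrite gt0_muley ?lte_fin.
Qed.
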